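(* There is a universal constant $c>0$ such that the following holds. Let $Y_1,\dots,Y_{2n},Y_{2n+1}$ be i.i.d. from some probability distribution $P$ on $\mathbb{R}$, let $k,m$ be positive integers, $\alpha\in(0,1)$, and let $\delta,\gamma>0$ satisfy $3\delta+\gamma+n^{-1}\le\alpha$. Let $S_1\subset\cdots\subset S_m\subset\mathbb{R}$ be a nested system of random sets, measurable with respect to the $\sigma$-field generated by $Y_1,\dots,Y_n$, such that, with $\mathbb{P}_n=\frac1n\sum_{i=1}^n\delta_{Y_i}$: (i) $\mathbb{P}_n(S_j)=\frac{j}{m}$ and $S_j\in\mathcal{C}_k$ for all $j\in\{1,\dots,m\}$; (ii) there exists $j^*\in\{1,\dots,m\}$ such that $\mathbb{P}_n(S_{j^*})\ge 1-\alpha+n^{-1}+3\delta$ and $\mathrm{vol}(S_{j^*})\le\mathrm{OPT}_k\big(\mathbb{P}_n,1-\alpha+\tfrac1n+3\delta+\gamma\big)$. Suppose $\delta\ge c\sqrt{\frac{k+\log n}{n}}$. Define the score $q(y)=\sum_{j=1}^m\mathbb{I}\{y\in S_j\}$, let $q_1\le\cdots\le q_n$ be the order statistics of $q(Y_{n+1}),\dots,q(Y_{2n})$, and let $$\widehat{C}_{\rm CP-DP}=\big\{y\in\mathbb{R}: q(y)\ge q_{\lfloor (n+1)\alpha\rfloor}\big\}.$$ Then: 1. (Coverage) $\mathbb{P}\big(Y_{2n+1}\in\widehat{C}_{\rm CP-DP}\big)\ge 1-\alpha$. 2. (Restricted volume optimality) $\mathrm{vol}(\widehat{C}_{\rm CP-DP})\le\mathrm{OPT}_k\big(P,1-\alpha+\tfrac1n+4\delta+\gamma\big)$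 with probability at least $1-2\delta$.
   Context: $\mathcal{C}_k$ is the collection of all subsets of $\mathbb{R}$ that are unions of $k$ intervals (some of the intervals may be empty or degenerate to a single point, so these are unions of at most $k$ intervals). $\mathrm{vol}$ is Lebesgue measure on $\mathbb{R}$. For a probability distribution $Q$ on $\mathbb{R}$, $\mathrm{OPT}_k(Q,t)=\inf\{\mathrm{vol}(C): C\in\mathcal{C}_k,\ Q(C)\ge t\}$, with $\inf\emptyset=+\infty$. $\mathbb{I}\{\cdot\}$ is the indicator function. In the coverage statement the probability is over all of $Y_1,\dots,Y_{2n+1}$. *)

(* Defs.v *)
From HB Require Import structures.
From mathcomp Require Import all_boot all_order all_algebra.
From mathcomp Require Import all_classical all_reals all_analysis.

Set Implicit Arguments.
Unset Strict Implicit.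
Unset Printing Implicit Defensive.

Import Order.TTheory GRing.Theory Num.Theory.
Import numFieldNormedType.Exports.

Local Open Scope classical_set_scope.
Local Open Scope ring_scope.

(* [interval R] includes empty, one-point and unbounded intervals, so this is
   the class of unions of at most [k] intervals. *)
Definition interval_unions (R : realType) (k : nat) : set (set R) :=
  [set C | exists I : 'I_k -> interval R, C = \bigcup_(i in setT) [set` I i]].

Definition OPT (R : realType) (k : nat) (Q : set R -> \bar R) (t : R) : \bar R :=
  ereal_inf [set lebesgue_measure C | C in
               [set C | interval_unions k C /\ (t%:E <= Q C)%E]].

Definition empirical (R : realType) (n : nat) (y : 'I_n -> R) (A : set R) :
    \bar R :=
  ((n%:R^-1)%:E * \sum_(i < n) \d_(y i) A)%E.

Definition mutually_independent d (T : measurableType d) (R : realType)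
    (P : probability T R) (I : finType) (X : I -> {RV P >-> R}) : Prop :=
  forall (J : {set I}) (B : I -> set R), (forall i, measurable (B i)) ->
    P (\bigcap_(i in [set` J]) (X i @^-1` B i)) =
    (\prod_(i in J) P (X i @^-1` B i))%E.

Definition iid d (T : measurableType d) (R : realType) (P : probability T R)
    (Q : probability (measurableTypeR R) R) (I : finType)
    (X : I -> {RV P >-> R}) : Prop :=
  (forall i (A : set R), measurable A -> distribution P (X i) A = Q A) /\
  mutually_independent X.

(* A random set is identified with its graph in [T * R], which is required to
   belong to the product of the sigma-algebra generated by [X] and the Borel
   sigma-algebra.  Asking only that [[set w | S w y]] be measurable for each
   [y] would not make the volume of [S w] or the event that a random point lies
   in [S w] measurable. *)
Definition random_set_measurable (T : Type) (R : realType) (n : nat)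
    (X : 'I_n -> T -> measurableTypeR R) (S : T -> set R) : Prop :=
  <<s [set A `*` B | A in g_sigma_preimage X
                   & B in (measurable : set (set (measurableTypeR R)))] >>
    [set p | S p.1 p.2].

(* The sample [Y_1, ..., Y_{2n+1}] is indexed by ['I_(n + n + 1)], split into
   [Y_1, ..., Y_n] (training), [Y_{n+1}, ..., Y_{2n}] (calibration) and
   [Y_{2n+1}] (test). *)
Definition train_idx (n : nat) (i : 'I_n) : 'I_(n + n + 1) :=
  lshift 1 (lshift n i).
Definition calib_idx (n : nat) (i : 'I_n) : 'I_(n + n + 1) :=
  lshift 1 (rshift n i).
Definition test_idx (n : nat) : 'I_(n + n + 1) := rshift (n + n) ord0.

Definition score (R : realType) (m : nat) (S : 'I_m -> set R) (y : R) : R :=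
  \sum_(j < m) \1_(S j) y.

(* The [r]-th smallest entry of [s], counted from [1]. *)
Definition order_stat (R : realType) (s : seq R) (r : nat) : R :=
  nth 0 (sort <=%R s) r.-1.

(* [Num.truncn] is the integer part of a nonnegative number. *)
Definition cpdp_set (R : realType) (n m : nat) (alpha : R)
    (S : 'I_m -> set R) (y : 'I_n -> R) : set R :=
  [set z | order_stat [seq score S (y i) | i <- enum 'I_n]
             (Num.truncn (n.+1%:R * alpha)) <= score S z].

(* Main.v *)
(** Coverage is exchangeability: given the training sample, the calibration and
    test scores are exchangeable, and at most [r] of [n + 1] reals have at most
    [r] of the others below them (themselves included).

    For the volume, the conformal set is contained in the near-optimal [S_j*] as
    soon as [S_j*] contains more than [n - r] calibration points, which holds if
    the training and calibration frequencies of all unions of [k] intervals are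
    uniformly [3 * delta]-close.  Swapping the [i]-th training point with the
    [i]-th calibration point at random reduces this closeness to a statement
    about sums of random signs for a fixed sample, which is proved by chaining
    over dyadic blocks of ranks.  Finally [S_j*] is no larger than any fixed
    [C0] whose empirical frequency is within [delta] of its probability, which
    is a Chernoff bound, and the volume of [C0] can be taken arbitrarily close to
    the infimum. *)

Require Import Defs.
From HB Require Import structures.
From mathcomp Require Import all_boot all_order all_algebra.
From mathcomp Require Import all_classical all_reals all_analysis.
From mathcomp Require Import measurable_realfun ring lra zify.

Set Implicit Arguments.
Unset Strict Implicit.
Unset Printing Implicit Defensive.

Import Order.TTheory GRing.Theory Num.Theory.
Import numFieldNormedType.Exports.

Local Open Scope classical_set_scope.
Local Open Scope ring_scope.

(** * Sums of random signs *)

Lemma leq_card_bigcup (I A : finType) (D : {pred I}) (B : I -> {set A}) :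
  (#|\bigcup_(i in D) B i|%SET <= \sum_(i in D) #|B i|)%N.
Proof.
apply: (big_rec2 (fun (X : {set A}) s => (#|X| <= s)%N)); first by rewrite cards0.
move=> i s X _ h; apply: leq_trans (leq_add (leqnn _) h).
by rewrite cardsU leq_subr.
Qed.

Section SignSums.
Variable R : realType.
Implicit Types (x t V : R).

Lemma expR_le_inv1B x : x < 1 -> expR x <= (1 - x)^-1.
Proof.
move=> x1; rewrite -[x in expR x]opprK expRN lef_pV2 ?posrE ?expR_gt0 ?subr_gt0//.
exact: expR_ge1Dx.
Qed.

(** Weak form of [cosh x <= exp (x^2 / 2)] with an elementary proof. For [0 <= x <= 1/2] the terms
    are at most [1/(1-x)] and [1/(1+x)], whose sum is [2/(1-x^2)]; beyond [1/2] already
    [x <= 2 * x^2]. *)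
Lemma expRD_expRN_le x : expR x + expR (- x) <= 2 * expR (2 * x ^+ 2).
Proof.
wlog x0 : x / 0 <= x => [hw|].
  have [/hw//|/ltW x0] := leP 0 x.
  by rewrite addrC -(sqrrN x) -{2}(opprK x); apply: hw; rewrite oppr_ge0.
have [x2|x2] := leP x (2^-1).
  have h1 : expR x <= (1 - x)^-1 by apply: expR_le_inv1B; lra.
  have h2 : expR (- x) <= (1 + x)^-1.
    by rewrite -{2}(opprK x); apply: expR_le_inv1B; lra.
  have h3 : (1 - x)^-1 + (1 + x)^-1 <= 2 * (1 + 2 * x ^+ 2).
    have -> : (1 - x)^-1 + (1 + x)^-1 = 2 / (1 - x ^+ 2).
      by field; apply/and3P; split; rewrite ?gt_eqF//; nra.
    rewrite ler_pM2l// -div1r ler_pdivrMr; last by nra.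
    have : 0 <= x ^+ 2 * (1 - 2 * x ^+ 2) by apply: mulr_ge0; nra.
    lra.
  apply: le_trans (lerD h1 h2) (le_trans h3 _).
  by rewrite ler_pM2l//; exact: expR_ge1Dx.
have h : expR (- x) <= expR x by rewrite ler_expR; lra.
have : expR x <= expR (2 * x ^+ 2) by rewrite ler_expR; nra.
lra.
Qed.

Lemma sum_signs_expR n (z : 'I_n -> R) :
  \sum_(e : {ffun 'I_n -> bool}) expR (\sum_i (-1) ^+ e i * z i)
    <= 2 ^+ n * expR (2 * \sum_i z i ^+ 2).
Proof.
under eq_bigr => e _ do rewrite expR_sum.
rewrite -(bigA_distr_bigA (fun i (b : bool) => expR ((-1) ^+ b * z i))).
rewrite mulr_sumr expR_sum.
have -> : 2 ^+ n = \prod_(i < n) (2 : R) by rewrite prodr_const card_ord.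
rewrite -big_split/=; apply: ler_prod => i _.
rewrite sumr_ge0 => [|b _]; last exact: expR_ge0.
by rewrite big_bool/= expr1 expr0 mul1r mulN1r addrC expRD_expRN_le.
Qed.

(** Exponential Markov inequality for a Rademacher sum, with counting of sign vectors in place of
    probability. *)
Lemma card_signs_gt n (z : 'I_n -> R) V t : 0 < V -> 0 <= t ->
  \sum_i z i ^+ 2 <= V ->
  #|[set e : {ffun 'I_n -> bool} | t < \sum_i (-1) ^+ e i * z i]%SET|%:R
    <= 2 ^+ n * expR (- (t ^+ 2 / (8 * V))).
Proof.
(* This [l] minimises [2 * l^2 * V - l * t]; the minimum is [- t^2 / (8 * V)]. *)
move=> V0 t0 zV; pose l := t / (4 * V).
have l0 : 0 <= l by rewrite divr_ge0// mulr_ge0// ltW.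
set A := finset _.
have h1 : #|A|%:R <= \sum_(e : {ffun 'I_n -> bool})
    expR (- (l * t)) * expR (\sum_i (-1) ^+ e i * (l * z i)).
  rewrite -sum1_card natr_sum big_mkcond/=; apply: ler_sum => e _.
  rewrite -expRD; case: ifPn => [|_]; last exact: expR_ge0.
  rewrite inE => te; apply: le_trans (expR_ge1Dx _); rewrite lerDl.
  under eq_bigr => i _ do rewrite mulrCA.
  by rewrite -mulr_sumr addrC -mulrBr; apply: mulr_ge0 => //; rewrite subr_ge0 ltW.
apply: (le_trans h1); rewrite -mulr_sumr.
apply: (@le_trans _ _ (expR (- (l * t)) * (2 ^+ n * expR (2 * (l ^+ 2 * V))))).
  rewrite ler_pM2l ?expR_gt0//; apply: (le_trans (sum_signs_expR _)).
  rewrite ler_pM2l ?exprn_gt0// ler_expR ler_pM2l//.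
  under eq_bigr => i _ do rewrite exprMn.
  by rewrite -mulr_sumr ler_wpM2l// exprn_ge0.
rewrite mulrCA -expRD ler_pM2l ?exprn_gt0// ler_expR /l.
by rewrite le_eqVlt; apply/orP; left; apply/eqP; field; rewrite ?gt_eqF.
Qed.

Lemma card_signs_sup_gt n (A : finType) (F : A -> 'I_n -> R) (D : {pred A}) V t :
  0 < V -> 0 <= t -> (forall a, a \in D -> \sum_i F a i ^+ 2 <= V) ->
  #|[set e : {ffun 'I_n -> bool} |
       [exists (a | a \in D), t < \sum_i (-1) ^+ e i * F a i]]%SET|%:R
    <= #|D|%:R * (2 ^+ n * expR (- (t ^+ 2 / (8 * V)))).
Proof.
move=> V0 t0 FV.
set B := finset _.
have -> : B = (\bigcup_(a in D)
    [set e : {ffun 'I_n -> bool} | t < \sum_i (-1) ^+ e i * F a i])%SET.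
  apply/setP => e; rewrite inE; apply/existsP/bigcupP.
    by move=> [a /andP[aD h]]; exists a => //; rewrite inE.
  by move=> [a aD]; rewrite inE => h; exists a; rewrite aD.
apply: (@le_trans _ _ (\sum_(a in D) #|[set e : {ffun 'I_n -> bool} |
    t < \sum_i (-1) ^+ e i * F a i]%SET|%:R)).
  by rewrite -natr_sum ler_nat leq_card_bigcup.
rewrite mulr_natl -sumr_const; apply: ler_sum => a aD.
exact: card_signs_gt (FV _ aD).
Qed.

(** Give each labelling the weight [x] to the number of its places that are not [None]. With at most
    [K] such places the weight is at least [x^K], and all weights sum to [(1 + 2 * x)^M]. *)
Lemma card_sparse M K x : 0 < x <= 1 ->
  #|[pred a : {ffun 'I_M -> option bool} |
       (#|[pred q | a q != None]| <= K)%N]|%:R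
    <= (x ^+ K)^-1 * expR (2 * x * M%:R).
Proof.
move=> /andP[x0 x1].
rewrite -sum1_card natr_sum.
apply: (@le_trans _ _ (\sum_(a : {ffun 'I_M -> option bool})
    (x ^+ K)^-1 * \prod_(q < M) (if a q != None then x else 1))).
  rewrite big_mkcond/=; apply: ler_sum => a _.
  rewrite -big_mkcond/= prodr_const.
  case: ifPn => [|_]; last by rewrite mulr_ge0// ?invr_ge0 exprn_ge0// ltW.
  rewrite inE => aK; rewrite -[1%:R](@mulVf _ (x ^+ K)) ?gt_eqF ?exprn_gt0//.
  rewrite ler_pM2l ?invr_gt0 ?exprn_gt0//.
  by rewrite ler_wiXn2l// ltW.
rewrite -mulr_sumr ler_pM2l ?invr_gt0 ?exprn_gt0//.
rewrite -(bigA_distr_bigA (fun i (b : option bool) => if b != None then x else 1)).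
rewrite (_ : 2 * x * M%:R = \sum_(i < M) 2 * x); last first.
  by rewrite sumr_const card_ord mulr_natr.
rewrite expR_sum; apply: ler_prod => i _.
have -> : \sum_(b : option bool) (if b != None then x else 1) = 1 + 2 * x.
  rewrite (bigD1 None)//= (eq_bigr (fun=> x)) => [|b /negbTE->//].
  by rewrite sumr_const cardC1 card_option card_bool mulr_natl.
by rewrite expR_ge1Dx andbT; lra.
Qed.
End SignSums.

(** * Chaining over dyadic blocks *)

Section Dyadic.
Variable R : realType.

Definition osign (o : option bool) : R := if o is Some b then (-1) ^+ b else 0.

(** One increment of the chain as a function of the rank [p]: on block [q] of length [2^(l+1)] it
    vanishes on the first half and is the sign coded by [a q] on the second. *)
Definition dyadic_level M l (a : 'I_M -> option bool) (p : nat) : R :=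
  if odd (p %/ 2 ^ l)%N then
    if insub (p %/ 2 ^ l.+1)%N is Some q then osign (a q) else 0
  else 0.

Lemma card_block (I : finType) (rho : I -> nat) b c : injective rho -> (0 < b)%N ->
  (#|[pred i | (rho i %/ b)%N == c]| <= b)%N.
Proof.
move=> rhoI b0; rewrite -[leqRHS]card_ord.
pose f i : 'I_b := Ordinal (ltn_pmod (rho i) b0).
have fI : {in [pred i | (rho i %/ b)%N == c] &, injective f}.
  move=> i j; rewrite !inE => /eqP ic /eqP jc [eqm]; apply: rhoI.
  by rewrite (divn_eq (rho i) b) (divn_eq (rho j) b) ic jc eqm.
by rewrite -(card_in_image fI) max_card.
Qed.

Lemma divn_expS p l : (p %/ 2 ^ l.+1)%N = ((p %/ 2 ^ l)./2)%N.
Proof. by rewrite expnSr divnMA divn2. Qed.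

(** Each labelled block contributes only through its second half, which holds at most [2^l] of the
    distinct ranks. *)
Lemma dyadic_level_energy (I : finType) (rho : I -> nat) M l
    (a : 'I_M -> option bool) : injective rho ->
  \sum_i dyadic_level l a (rho i) ^+ 2 <= (#|[pred q | a q != None]| * 2 ^ l)%:R.
Proof.
move=> rhoI.
apply: (@le_trans _ _ (\sum_i \sum_(q < M | a q != None)
   ((rho i %/ 2 ^ l)%N == q.*2.+1)%:R)).
  apply: ler_sum => i _; rewrite /dyadic_level.
  have s0 : 0 <= \sum_(q < M | a q != None) ((rho i %/ 2 ^ l)%N == q.*2.+1)%:R :> R.
    by apply: sumr_ge0.
  case: ifPn => od; last by rewrite expr0n.
  case: insubP => [q _ qE|_]; last by rewrite expr0n.
  case E : (a q) => [b|]; last by rewrite expr0n.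
  rewrite /= sqrr_sign (bigD1 q) ?E//= qE divn_expS.
  rewrite -[X in (X == _)]odd_double_half od add1n eqxx lerDl.
  by apply: sumr_ge0.
rewrite exchange_big/= natrM -sum1_card natr_sum mulr_suml.
apply: ler_sum => q _; rewrite -natr_sum mul1r ler_nat.
apply: leq_trans (card_block q.*2.+1 rhoI (expn_gt0 2 l)).
by rewrite -sum1_card [leqRHS]big_mkcond/= leq_sum.
Qed.

Definition dyadic_floor l p := (p %/ 2 ^ l * 2 ^ l)%N.

(** Compares [h] at the start and at the midpoint of block [q]. The value at the start fixes the
    sign: [Some true] is a drop, and [osign] sends it to -1. *)
Definition dyadic_jump (h : nat -> bool) l q : option bool :=
  if h (q.*2 * 2 ^ l)%N == h (q.*2.+1 * 2 ^ l)%N then None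
  else Some (h (q.*2 * 2 ^ l)%N).

(** The two roundings of [p] differ only if [p] lies in the second half of its block of length
    [2^(l+1)]; they are then its midpoint and its start. *)
Lemma dyadic_floorB (h : nat -> bool) M l p : (p < M * 2 ^ l.+1)%N ->
  (h (dyadic_floor l p))%:R - (h (dyadic_floor l.+1 p))%:R
    = dyadic_level l (fun q : 'I_M => dyadic_jump h l q) p.
Proof.
move=> pM; rewrite /dyadic_level /dyadic_floor /dyadic_jump.
have qM : (p %/ 2 ^ l.+1 < M)%N by rewrite ltn_divLR ?expn_gt0.
rewrite insubT /=.
have -> : (p %/ 2 ^ l.+1 * 2 ^ l.+1 = (p %/ 2 ^ l.+1)%N.*2 * 2 ^ l)%N.
  by rewrite expnS mulnA muln2.
rewrite !divn_expS -[X in h (X * _)%N]odd_double_half.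
case: ifPn => od; last by rewrite add0n subrr.
rewrite add1n; case: (h (_.*2 * _)%N); case: (h (_.+1 * _)%N) => /=;
by rewrite ?subrr ?subr0 ?sub0r ?expr1 ?expr0.
Qed.

Lemma dyadic_telescope (h : nat -> bool) l p :
  (h p)%:R = (h (dyadic_floor l p))%:R +
    \sum_(i < l) ((h (dyadic_floor i p))%:R - (h (dyadic_floor i.+1 p))%:R) :> R.
Proof.
rewrite -(big_mkord xpredT
  (fun i => (h (dyadic_floor i p))%:R - (h (dyadic_floor i.+1 p))%:R)).
rewrite (telescope_sumr_eq (fun i => - (h (dyadic_floor i p))%:R))//; last first.
  by move=> i _; rewrite opprK addrC.
by rewrite opprK addrA subrr add0r /dyadic_floor expn0 divn1 muln1.
Qed.

(** Closed intervals suffice, since only traces on a finite sample matter; see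
    [interval_unions_trace]. *)
Definition in_intervals (cs : seq (R * R)) (z : R) :=
  has (fun c => c.1 <= z <= c.2) cs.

(** Membership in [[a, b]] can change between [u q] and [v q] only if [a] or [b] is crossed there.
    The stretches from [u q] to [v q] follow one another, so each endpoint is crossed for at most
    one [q]. *)
Lemma card_crossing M cs (u v : nat -> R) :
  (forall q, u q <= v q) -> (forall q q', (q < q')%N -> v q <= u q') ->
  (#|[pred q : 'I_M | in_intervals cs (u q) != in_intervals cs (v q)]|
     <= 2 * size cs)%N.
Proof.
move=> uv vu; elim: cs => [|[a b] cs ih].
  by rewrite muln0 leqn0; apply/eqP/eq_card0 => q; rewrite inE.
pose A := [pred q : 'I_M | u q < a <= v q].
pose B := [pred q : 'I_M | u q <= b < v q].
have A1 : (#|A| <= 1)%N.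
  apply/card_le1_eqP => q q'; rewrite !inE => /andP[h1 h2] /andP[h3 h4].
  case: (ltngtP (val q) (val q')) => [/vu h|/vu h|/ord_inj//].
    by have := le_lt_trans (le_trans h2 h) h3; rewrite ltxx.
  by have := le_lt_trans (le_trans h4 h) h1; rewrite ltxx.
have B1 : (#|B| <= 1)%N.
  apply/card_le1_eqP => q q'; rewrite !inE => /andP[h1 h2] /andP[h3 h4].
  case: (ltngtP (val q) (val q')) => [/vu h|/vu h|/ord_inj//].
    by have := lt_le_trans h2 (le_trans h h3); rewrite ltxx.
  by have := lt_le_trans h4 (le_trans h h1); rewrite ltxx.
rewrite mulnS (_ : 2 = 1 + 1)%N//.
apply: leq_trans (leq_add (leq_add A1 B1) ih).
rewrite -!sum1_card big_mkcond/= [X in (_ <= X + _ + _)%N]big_mkcond/=.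
rewrite [X in (_ <= _ + X + _)%N]big_mkcond [X in (_ <= _ + _ + X)%N]big_mkcond/=.
rewrite -!big_split/=; apply: leq_sum => q _; rewrite !inE /= !ltNge.
have au : a <= u q -> a <= v q by move/le_trans; apply.
have bv : v q <= b -> u q <= b by apply: le_trans.
move: au bv; case: (a <= u q); case: (a <= v q); case: (u q <= b);
case: (v q <= b) => //=; do 2 (case: in_intervals => //=); move=> h1 h2;
by [have := h1 isT | have := h2 isT].
Qed.
End Dyadic.

(** * Ranks, and union bounds at a single scale *)

Section Discrepancy.
Variable R : realType.

Lemma sorted_ranks (I : finType) (y : I -> R) : (0 < #|I|)%N ->
  exists (s : nat -> R) (rho : I -> nat),
    [/\ {homo s : p q / (p <= q)%N >-> p <= q}, injective rho,
        forall i, (rho i < #|I|)%N & forall i, y i = s (rho i)].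
Proof.
move=> /card_gt0P[i0 _].
pose r := relpre y <=%R; pose sl := sort r (enum I).
have sz : size sl = #|I| by rewrite size_sort cardE.
have mem_sl i : i \in sl by rewrite mem_sort mem_enum.
have ltI i : (index i sl < #|I|)%N by rewrite -sz index_mem.
have I0 : (0 < #|I|)%N by apply: leq_trans (ltI i0).
(* Capping the position with [minn] keeps [s] monotone on all of [nat]; the dyadic blocks later
   reach beyond the last rank. *)
exists (fun p => y (nth i0 sl (minn p #|I|.-1))), (fun i => index i sl); split => //.
- move=> p q pq.
  have rt : transitive r by move=> a b c; exact: le_trans.
  have ss : sorted r sl by apply: sort_sorted => a b; exact: le_total.
  apply: (sorted_leq_nth rt _ i0 ss); rewrite ?inE ?sz; try by lia.
  by move=> a; rewrite /r /=.
- by move=> i j; apply: index_inj.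
- move=> i; congr y; rewrite (_ : minn _ _ = index i sl) ?nth_index//.
  by have := ltI i; lia.
Qed.

Lemma two_le_expR1 : 2 <= expR 1 :> R.
Proof. by have := @expR_ge1Dx R 1; rewrite -[1 + 1]/(2%:R). Qed.

Lemma bernoulli_half (j : nat) : 1 + j%:R / 2 <= (3 / 2) ^+ j :> R.
Proof.
elim: j => [|j ih]; first by rewrite mul0r addr0 expr0.
have j0 : 0 <= j%:R :> R by [].
by rewrite exprS -natr1; nra.
Qed.

Lemma sum_geom78 m : \sum_(l < m) (7 / 8) ^+ (m - l.+1) <= 8 :> R.
Proof.
rewrite (reindex_inj rev_ord_inj)/=.
rewrite (eq_bigr (fun i : 'I_m => (7 / 8) ^+ i)); last first.
  by move=> i _; congr (_ ^+ _); have := ltn_ord i; lia.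
have -> : \sum_(i < m) (7 / 8) ^+ i = 8 * (1 - (7 / 8) ^+ m) :> R.
  elim: m => [|m ih]; first by rewrite big_ord0 expr0 subrr mulr0.
  by rewrite big_ord_recr/= ih exprS; field.
have : 0 <= (7 / 8) ^+ m :> R by apply: exprn_ge0; lra.
lra.
Qed.

Lemma sum_sqrB_le n (f : bool * 'I_n -> R) :
  \sum_i (f (false, i) - f (true, i)) ^+ 2 <= 2 * \sum_x f x ^+ 2.
Proof.
rewrite (eq_bigr (fun p => f (p.1, p.2) ^+ 2)) => [|[]//].
rewrite -(pair_bigA _ (fun b i => f (b, i) ^+ 2))/= big_bool/=.
rewrite -big_split mulr_sumr/=; apply: ler_sum => i _.
have := sqr_ge0 (f (true, i) + f (false, i)); nra.
Qed.

(** Union bound over the possible increments at level [l]. Their number gives the first term of the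
    exponent, and the energy bound, doubled by taking differences, gives the variance
    [4 * k * 2^l]. *)
Lemma card_level_gt n (rho : bool * 'I_n -> nat) k j l M (t : R) :
  injective rho -> (0 < k)%N -> 0 <= t -> (M <= 2 * k * 2 ^ j)%N ->
  #|[set e : {ffun 'I_n -> bool} | [exists (a : {ffun 'I_M -> option bool} |
      a \in [pred a : {ffun 'I_M -> option bool} |
               (#|[pred q | a q != None]| <= 2 * k)%N]),
      t < \sum_i (-1) ^+ e i * (dyadic_level R l a (rho (false, i))
                                - dyadic_level R l a (rho (true, i)))]]%SET|%:R
  <= 2 ^+ n * expR (2 * k%:R * (j%:R + 2) - t ^+ 2 / (32 * k%:R * 2 ^+ l)).
Proof.
move=> rhoI k0 t0 Mk.
have kR : 0 < k%:R :> R by rewrite ltr0n.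
(* With this weight [x^(-2k)] is at most [exp (2 * k * (j + 1))], and [2 * x * M] is at most
   [2 * k]. *)
pose x : R := (2 ^+ j.+1)^-1.
have x01 : 0 < x <= 1.
  by rewrite invr_gt0 exprn_gt0//= invf_le1 ?exprn_gt0// exprn_ege1// ler1n.
have V0 : 0 < 4 * k%:R * 2 ^+ l :> R by rewrite !mulr_gt0// exprn_gt0.
apply: le_trans (card_signs_sup_gt V0 t0 _) _.
  move=> a; rewrite inE => ak.
  apply: le_trans (sum_sqrB_le (fun z => dyadic_level R l a (rho z))) _.
  rewrite (_ : 4 * _ * _ = 2 * (2 * k * 2 ^ l)%:R); last first.
    by rewrite !natrM natrX; ring.
  rewrite ler_pM2l//; apply: le_trans (dyadic_level_energy R l a rhoI) _.
  by rewrite ler_nat leq_mul2r ak orbT.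
rewrite mulrCA ler_pM2l ?exprn_gt0//.
apply: (@le_trans _ _ (expR (2 * k%:R * (j%:R + 2)) *
    expR (- (t ^+ 2 / (8 * (4 * k%:R * 2 ^+ l)))))); last first.
  by rewrite -expRD (_ : 8 * (4 * _ * _) = 32 * k%:R * 2 ^+ l)//; ring.
rewrite ler_pM2r ?expR_gt0//.
apply: le_trans (card_sparse M (2 * k) x01) _.
rewrite (_ : 2 * k%:R * (j%:R + 2) = (2 * k * j.+1)%:R * 1 + 2 * k%:R); last first.
  by rewrite !natrM -natr1; ring.
rewrite expRD expRM_natl; apply: ler_pM; rewrite ?expR_ge0 ?invr_ge0 ?exprn_ge0//.
- by case/andP: x01 => /ltW.
- rewrite /x exprVn invrK -exprM mulnC.
  by apply: lerXn2r; rewrite ?nnegrE ?expR_ge0// two_le_expR1.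
- rewrite ler_expR /x exprS invfM -(@ler_pM2r _ (2 ^+ j)) ?exprn_gt0//.
  rewrite (_ : _ * M%:R * _ = M%:R); last first.
    have : (2 : R) ^+ j != 0 by rewrite expf_neq0.
    by move: (2 ^+ j) => z z0; field.
  by rewrite -natrX -!natrM ler_nat.
Qed.

Lemma card_base_gt n (rho : bool * 'I_n -> nat) k N b (t : R) :
  (0 < n)%N -> 0 <= t -> (N <= 2 * k)%N ->
  #|[set e : {ffun 'I_n -> bool} | [exists (g : {ffun 'I_N -> bool} | g \in xpredT),
      t < \sum_i (-1) ^+ e i *
        ((oapp g false (insub (rho (false, i) %/ b)%N))%:R
         - (oapp g false (insub (rho (true, i) %/ b)%N))%:R)]]%SET|%:R
  <= 2 ^+ n * expR (2 * k%:R - t ^+ 2 / (8 * n%:R)).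
Proof.
move=> n0 t0 Nk.
have V0 : 0 < n%:R :> R by rewrite ltr0n.
apply: le_trans (card_signs_sup_gt V0 t0 _) _.
  move=> g _; rewrite -[X in X%:R]card_ord -sum1_card natr_sum.
  apply: ler_sum => i _; do 2 case: (oapp _ _ _);
  by rewrite ?subrr ?subr0 ?sub0r ?sqrrN ?expr1n ?expr0n.
rewrite mulrCA ler_pM2l ?exprn_gt0// expRD ler_pM2r ?expR_gt0//.
rewrite (_ : #|_| = 2 ^ N)%N; last by rewrite cardT -cardE card_ffun card_bool card_ord.
rewrite natrX; apply: (@le_trans _ _ (2 ^+ (2 * k))).
  by rewrite ler_weXn2l// ler1n.
rewrite -natrM -[X in expR X]mulr1 expRM_natl.
by apply: lerXn2r; rewrite ?nnegrE ?expR_ge0// two_le_expR1.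
Qed.

End Discrepancy.

(** * Choice of thresholds and summation over the scales *)

Section Chaining.
Variable R : realType.

(** The ratio [7/8] works because [2 * (7/8)^2 >= 3/2]: the variance term is at least
    [(4k + u) * (3/2)^j], hence at least [(4k + u) * (1 + j/2)], while the entropy term equals
    [4k * (1 + j/2)]. *)
Lemma level_exponent (n k j l : nat) (u T : R) : (0 < n)%N -> (0 < k)%N ->
  0 <= u -> 64 * n%:R * (4 * k%:R + u) <= T ^+ 2 ->
  (k * 2 ^ l * 2 ^ j <= 2 * n)%N ->
  2 * k%:R * (j%:R + 2) - (T * (7 / 8) ^+ j) ^+ 2 / (32 * k%:R * 2 ^+ l) <= - u.
Proof.
move=> n0 k0 u0 hT hk.
have kR : 0 < k%:R :> R by rewrite ltr0n.
have nR : 0 < n%:R :> R by rewrite ltr0n.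
have j0 : 0 <= j%:R :> R by [].
have l0 : 0 < 2 ^+ l :> R by rewrite exprn_gt0.
have p0 : 0 < 2 ^+ j :> R by rewrite exprn_gt0.
have hk' : k%:R * 2 ^+ l * 2 ^+ j <= 2 * n%:R :> R.
  by rewrite -!natrX -!natrM ler_nat.
have D0 : 0 < 32 * k%:R * 2 ^+ l :> R by rewrite !mulr_gt0.
have X0 : (4 * k%:R + u) * (1 + j%:R / 2) <=
    (T * (7 / 8) ^+ j) ^+ 2 / (32 * k%:R * 2 ^+ l).
  rewrite ler_pdivlMr//.
  have h32 : (3 / 2) ^+ j <= 2 ^+ j * ((7 / 8) ^+ j) ^+ 2 :> R.
    by rewrite -exprM mulnC exprM -exprMn; apply: lerXn2r; rewrite ?nnegrE; lra.
  have b := le_trans (bernoulli_half R j) h32.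
  rewrite exprMn.
  move: b hk' hT l0 p0; set q := (7 / 8) ^+ j; set a := 2 ^+ l; set c := 2 ^+ j.
  move=> b hk' hT l0 p0.
  have q0 : 0 <= q ^+ 2 by exact: sqr_ge0.
  have W0 : 0 <= 4 * k%:R + u by rewrite addr_ge0// mulr_ge0// ltW.
  apply: (@le_trans _ _ ((4 * k%:R + u) * (c * q ^+ 2) * (32 * k%:R * a))).
    by rewrite ler_wpM2r ?(ltW D0)// ler_wpM2l.
  apply: (@le_trans _ _ (64 * n%:R * (4 * k%:R + u) * q ^+ 2)); last first.
    by rewrite ler_wpM2r.
  have -> : (4 * k%:R + u) * (c * q ^+ 2) * (32 * k%:R * a) =
     (32 * (4 * k%:R + u) * q ^+ 2) * (k%:R * a * c) by ring.
  have -> : 64 * n%:R * (4 * k%:R + u) * q ^+ 2 =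
     (32 * (4 * k%:R + u) * q ^+ 2) * (2 * n%:R) by ring.
  by rewrite ler_wpM2l// mulr_ge0// mulr_ge0.
apply: le_trans (lerB (lexx _) X0) _.
nra.
Qed.

Lemma base_exponent (n k : nat) (u T : R) : (0 < n)%N ->
  0 <= u -> 64 * n%:R * (4 * k%:R + u) <= T ^+ 2 ->
  2 * k%:R - T ^+ 2 / (8 * n%:R) <= - u.
Proof.
move=> n0 u0 hT.
have nR : 0 < n%:R :> R by rewrite ltr0n.
have k0 : 0 <= k%:R :> R by [].
have : 8 * (4 * k%:R + u) <= T ^+ 2 / (8 * n%:R).
  rewrite ler_pdivlMr ?mulr_gt0//; apply: le_trans hT.
  by rewrite le_eqVlt; apply/orP; left; apply/eqP; ring.
lra.
Qed.

(* Between consecutive dyadic scales the indicator of a union of [k] intervals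
   changes on at most [2 * k] blocks.  With [2 ^ e <= 2 * k] blocks at the
   coarsest scale, the union bound [j] scales further down costs only
   [exp (2 * k * (j + 2))], while the variance decreases like [2 ^ - j]; hence
   the thresholds [T * (7 / 8) ^ j], which together with the base threshold [T]
   sum to at most [9 * T].  A union bound over all traces of unions of [k]
   intervals would lose a factor of order [log (n / k)]. *)
Lemma card_discrepancy n k (y : bool * 'I_n -> R) (u T : R) :
  (0 < n)%N -> (0 < k <= n)%N -> 0 <= u -> 0 <= T ->
  64 * n%:R * (4 * k%:R + u) <= T ^+ 2 ->
  #|[set e : {ffun 'I_n -> bool} | `[< exists2 cs : seq (R * R), (size cs <= k)%N &
      9 * T < \sum_i (-1) ^+ e i * ((in_intervals cs (y (false, i)))%:R
                                   - (in_intervals cs (y (true, i)))%:R) >]]%SET|%:R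
    <= 2 ^+ n * ((4 * n)%:R * expR (- u)).
Proof.
move=> n0 /andP[k0 kn] u0 T0 hT.
have cI : #|{: bool * 'I_n}| = (2 * n)%N by rewrite card_prod card_bool card_ord.
have I0 : (0 < #|{: bool * 'I_n}|)%N by rewrite cI; lia.
have [s [rho [smon rhoI rholt yE]]] := sorted_ranks y I0.
(* The [2n] ranks fit into [2^L], cut into [2^e] coarsest blocks with [k <= 2^e <= 2k]; [l0 = L - e]
   halvings lead down to single ranks. *)
pose L := up_log 2 (2 * n); pose e := up_log 2 k.
have /andP[L1 L2] : (2 ^ L.-1 < 2 * n <= 2 ^ L)%N by apply: up_log_bounds => //; lia.
have L0 : (0 < L)%N by rewrite up_log_gt0; lia.
have e2 : (k <= 2 ^ e)%N by apply: up_logP.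
have e1 : (2 ^ e <= 2 * k)%N.
  case: (ltngtP k 1) => [|k1|k1]; first by rewrite ltnNge k0.
    have /andP[h _] : (2 ^ e.-1 < k <= 2 ^ e)%N by apply: up_log_bounds.
    have e0 : (0 < e)%N by rewrite up_log_gt0.
    by rewrite -(prednK e0) expnS leq_pmul2l// ltnW.
  by rewrite /e k1 up_log1.
have eL : (e <= L)%N by apply: leq_up_log; lia.
have L4 : (2 ^ L < 4 * n)%N by rewrite -(prednK L0) expnS; lia.
pose l0 := (L - e)%N.
have Ll : (L = e + l0)%N by rewrite /l0 subnKC.
have rhoL x : (rho x < 2 ^ L)%N by apply: leq_trans (rholt x) _; rewrite cI.
(* The number of blocks of length [2^(l+1)]. *)
pose M l := (2 ^ e * 2 ^ (l0 - l.+1))%N.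
pose B0 := [set f : {ffun 'I_n -> bool} |
    [exists (g : {ffun 'I_(2 ^ e) -> bool} | g \in xpredT),
      T < \sum_i (-1) ^+ f i *
        ((oapp g false (insub (rho (false, i) %/ 2 ^ l0)%N))%:R
         - (oapp g false (insub (rho (true, i) %/ 2 ^ l0)%N))%:R)]]%SET.
pose B l := [set f : {ffun 'I_n -> bool} | [exists (a : {ffun 'I_(M l) -> option bool} |
      a \in [pred a : {ffun 'I_(M l) -> option bool} |
               (#|[pred q | a q != None]| <= 2 * k)%N]),
      T * (7 / 8) ^+ (l0 - l.+1) <
       \sum_i (-1) ^+ f i * (dyadic_level R l a (rho (false, i))
                                - dyadic_level R l a (rho (true, i)))]]%SET.
have hB0 : #|B0|%:R <= 2 ^+ n * expR (- u).
  apply: le_trans (card_base_gt rho (2 ^ l0) n0 T0 e1) _.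
  by rewrite ler_pM2l ?exprn_gt0// ler_expR; exact: base_exponent.
have hB l : (l < l0)%N -> #|B l|%:R <= 2 ^+ n * expR (- u).
  move=> ll.
  apply: le_trans (@card_level_gt R n rho k (l0 - l.+1) l (M l) _ rhoI k0 _ _) _.
  - by rewrite mulr_ge0// exprn_ge0.
  - by rewrite leq_mul2r e1 orbT.
  rewrite ler_pM2l ?exprn_gt0// ler_expR; apply: (@level_exponent n) => //.
  apply: (@leq_trans (2 ^ e * 2 ^ l * 2 ^ (l0 - l.+1))%N).
    by rewrite -!mulnA leq_mul2r e2 orbT.
  rewrite -!expnD (_ : _ + _ + _ = L.-1)%N; first exact: ltnW.
  by rewrite Ll; lia.
(* There are [l0 + 1] bad events with the same bound, and [l0 <= L < 2^L < 4n]. *)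
apply: (@le_trans _ _ (#|B0|%:R + \sum_(l < l0) #|B l|%:R)); last first.
  apply: (@le_trans _ _ (2 ^+ n * expR (- u) + \sum_(l < l0) 2 ^+ n * expR (- u))).
    by apply: lerD => //; apply: ler_sum => l _; exact: hB.
  rewrite sumr_const card_ord -mulrS -(mulr_natl (_ * _)) mulrCA ler_pM2l ?exprn_gt0//.
  rewrite ler_pM2r ?expR_gt0// ler_nat.
  have : (L < 2 ^ L)%N by apply: ltn_expl.
  lia.
apply: (@le_trans _ _ (#|B0 :|: \bigcup_(l < l0) B l|%SET)%:R); last first.
  rewrite -natr_sum -natrD ler_nat cardsU.
  apply: leq_trans (leq_subr _ _) _; rewrite leq_add2l.
  exact: (leq_card_bigcup xpredT).
(* By contraposition: outside all bad events the signed sum telescopes into the base term, at most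
   [T], and the increments, at most [8 * T] in total. *)
rewrite ler_nat; apply/subset_leq_card/fintype.subsetP => f; rewrite inE.
move=> /asboolP[cs csk hf]; apply: contraLR hf.
rewrite inE negb_or => /andP[f0 /finset.bigcupP fl]; rewrite -leNgt.
pose h p := in_intervals cs (s p).
pose z (F : nat -> R) := \sum_i (-1) ^+ f i * (F (rho (false, i)) - F (rho (true, i))).
have zE F G : (forall p, (p < 2 ^ L)%N -> F p = G p) -> z F = z G.
  by move=> FG; apply: eq_bigr => i _; rewrite !FG.
pose FT l p : R := (h (dyadic_floor l p))%:R.
have -> : \sum_i (-1) ^+ f i * ((in_intervals cs (y (false, i)))%:R
    - (in_intervals cs (y (true, i)))%:R) = z (FT l0) +
    \sum_(l < l0) z (fun p => FT l p - FT l.+1 p).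
  rewrite exchange_big/= -big_split/=; apply: eq_bigr => i _.
  rewrite -mulr_sumr -mulrDr; congr (_ * _).
  rewrite sumrB !yE -/(h _) -/(h (rho (true, i))).
  rewrite (dyadic_telescope R h l0 (rho (false, i))).
  by rewrite (dyadic_telescope R h l0 (rho (true, i))) /FT; ring.
rewrite (_ : 9 * T = T + T * 8); last by ring.
apply: lerD.
  move: f0; rewrite inE negb_exists => /forallP/(_ [ffun q : 'I__ => h (q * 2 ^ l0)%N]).
  rewrite /= -leNgt => f0; apply: le_trans f0; rewrite le_eqVlt; apply/orP; left.
  apply/eqP/(zE _ (fun p => (oapp [ffun q : 'I__ => h (q * 2 ^ l0)%N] false
     (insub (p %/ 2 ^ l0)%N))%:R)) => p pL.
  rewrite insubT; first by rewrite ltn_divLR ?expn_gt0// -expnD -Ll.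
  by move=> pe; rewrite /= ffunE.
apply: le_trans (ler_wpM2l T0 (sum_geom78 R l0)); rewrite mulr_sumr.
apply: ler_sum => l _.
pose a := [ffun q : 'I_(M l) => dyadic_jump h l q].
have aE : [pred q | a q != None] =i [pred q : 'I_(M l) |
   in_intervals cs (s (q.*2 * 2 ^ l)%N) != in_intervals cs (s (q.*2.+1 * 2 ^ l)%N)].
  by move=> q; rewrite !inE ffunE /dyadic_jump /h; case: ifP.
have : f \notin B l by apply/negP => fB; apply: fl; exists l.
rewrite inE negb_exists => /forallP/(_ a); rewrite inE negb_and (eq_card aE).
rewrite (_ : (_ <= _)%N)/=; last first.
  apply: leq_trans (_ : 2 * size cs <= _)%N; last by rewrite leq_mul2l csk orbT.
  apply: (@card_crossing R (M l) cs (fun q => s (q.*2 * 2 ^ l)%N)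
    (fun q => s (q.*2.+1 * 2 ^ l)%N)).
    by move=> q; apply: smon; rewrite leq_mul2r leqnSn orbT.
  by move=> q q' qq; apply: smon; rewrite leq_mul2r; apply/orP; right; lia.
rewrite -leNgt; apply: le_trans; rewrite le_eqVlt; apply/orP; left.
apply/eqP/zE => p pL; rewrite /FT (@dyadic_floorB R h (M l)); last first.
  rewrite /M -mulnA -expnD (_ : _ - _ + _ = l0)%N ?subnK// -expnD -Ll//.
by rewrite /dyadic_level; case: ifP => // _; case: insub => //= q; rewrite ffunE.
Qed.
End Chaining.

(** * Measurability and exchangeability *)

Section Measure.

Lemma measurable_pattern d (T : measurableType d) (A : finType)
    (P : A -> T -> bool) (Phi : {set A} -> Prop) :
  (forall a, measurable [set x | P a x]) ->
  measurable [set x | Phi [set a | P a x]%SET].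
Proof.
move=> mP.
pose F (s : {set A}) := \bigcap_(a in [set: A])
  (if a \in s then [set x | P a x] else ~` [set x | P a x]).
have -> : [set x | Phi [set a | P a x]%SET] =
    \bigcup_(s in [set s : {set A} | Phi s]) F s.
  apply/seteqP; split => x /=.
    move=> h; exists [set a | P a x]%SET => // a _ /=.
    by rewrite inE; case: ifPn => //= /negP.
  move=> [s /= hs Fx]; rewrite (_ : finset _ = s)//.
  apply/setP => a; rewrite inE; have := Fx a I.
  by case: ifPn => /= [_ ->|_ /negP/negbTE].
apply: fin_bigcup_measurable; first exact: finite_finset.
move=> s _; apply: fin_bigcap_measurable; first exact: finite_finset.
by move=> a _; case: ifP => // _; exact: measurableC.
Qed.

(** Integrating the number of events that occur turns a count valid for every outcome into a bound
    on probabilities. Both the coverage and the random swapping argument rest on this. *)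
Lemma sum_measure_le d (T : measurableType d) (R : realType)
    (Pr : probability T R) (A : finType) (E : A -> set T) (K : R) :
  (forall a, measurable (E a)) ->
  (forall w, #|[set a | `[< E a w >]]%SET|%:R <= K) ->
  (\sum_a Pr (E a) <= K%:E)%E.
Proof.
move=> mE EK.
have K0 : 0 <= K by apply: le_trans (EK point).
rewrite (eq_bigr (fun a => \int[Pr]_x (\1_(E a) x)%:E))%E; last first.
  by move=> a _; rewrite integral_indic// setIT.
rewrite -ge0_integral_sum//; last first.
  by move=> a; apply/measurable_EFinP; exact: measurable_indic.
apply: (@le_trans _ _ (\int[Pr]_x (cst K%:E x))%E).
  apply: ge0_le_integral => //.
  - by move=> x _; apply: sume_ge0 => a _; rewrite lee_fin.
  - by apply: emeasurable_sum => a; apply/measurable_EFinP; exact: measurable_indic.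
  - move=> x _ /=; rewrite sumEFin lee_fin; apply: le_trans (EK x).
    rewrite -sum1_card natr_sum [leRHS]big_mkcond/=.
    apply: ler_sum => a _; rewrite inE indicE.
    by case: asboolP => Eax; [rewrite mem_set|rewrite memNset].
by rewrite integral_cst// [X in (_ * X)%E]probability_setT mule1.
Qed.

Lemma measurable_tuple_of d (T : measurableType d) (R : realType)
    (N : nat) (X : 'I_N -> T -> measurableTypeR R) :
  (forall i, measurable_fun setT (X i)) ->
  measurable_fun setT (fun w => [tuple X i w | i < N]).
Proof.
move=> mX; apply/measurable_fun_tnthP => i.
rewrite (_ : _ \o _ = X i)//; apply/funext => w /=.
by rewrite tnth_mktuple.
Qed.

Definition tuple_rect (R : realType) N : set (set (N.-tuple (measurableTypeR R))) :=
  [set A | exists2 B : 'I_N -> set R, (forall i, measurable (B i)) &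
           A = [set t | forall i, B i (tnth t i)]].

Lemma measurable_tuple_rect (R : realType) N :
  measurable = <<s @tuple_rect R N >>.
Proof.
apply/seteqP; split.
  apply: smallest_sub; first exact: smallest_sigma_algebra.
  rewrite -bigcup_seq => A [i _ [B mB <-]]; apply: sub_sigma_algebra.
  exists (fun j => if j == i then B else setT).
    by move=> j; case: ifP.
  rewrite setTI; apply/seteqP; split => t /=.
    by move=> Bt j; case: eqP => [->|].
  by move=> /(_ i); rewrite eqxx.
apply: smallest_sub; first exact: sigma_algebra_measurable.
move=> _ [B mB ->].
rewrite (_ : [set t | _] = \bigcap_(i in [set: 'I_N])
    ((fun t : N.-tuple (measurableTypeR R) => tnth t i) @^-1` B i)).
  apply: fin_bigcap_measurable => [|i _]; first exact: finite_finset.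
  by have := @measurable_tnth _ (measurableTypeR R) N i measurableT _ (mB i);
    rewrite setTI.
by apply/seteqP; split => t /= h i; [move=> _; exact: h|exact: (h i I)].
Qed.

Lemma tuple_rect_setI (R : realType) N : setI_closed (@tuple_rect R N).
Proof.
move=> _ _ [A mA ->] [B mB ->]; exists (fun i => A i `&` B i).
  by move=> i; exact: measurableI.
apply/seteqP; split => t /=; first by move=> [h1 h2] i.
by move=> h; split => i; have [] := h i.
Qed.

Lemma measure_preimage_unique d d' (T : measurableType d) (U : measurableType d')
    (R : realType) (Pr : probability T R) (G : set (set U)) (f g : T -> U) :
  measurable_fun setT f -> measurable_fun setT g ->
  measurable = <<s G >> -> setI_closed G -> G setT ->
  (forall A, G A -> Pr (f @^-1` A) = Pr (g @^-1` A)) ->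
  forall A, measurable A -> Pr (f @^-1` A) = Pr (g @^-1` A).
Proof.
move=> mf mg GE GI GT fg A mA.
apply: (@measure_unique _ R _ G (fun=> setT) GE GI _ _
  (distribution Pr (mfun_Sub (mem_set mf)))
  (distribution Pr (mfun_Sub (mem_set mg)))) => //.
  by rewrite bigcup_const.
by move=> _; apply: le_lt_trans (probability_le1 _ measurableT) (ltry 1).
Qed.

(** * Exchangeability of an i.i.d. sample *)

Section Iid.
Context d (T : measurableType d) (R : realType) (Pr : probability T R).
Variables (P : probability (measurableTypeR R) R) (N : nat).
Variable Y : 'I_N -> {RV Pr >-> R}.
Hypothesis iidY : iid P Y.

Lemma iid_rect (B : 'I_N -> set R) : (forall i, measurable (B i)) ->
  Pr [set w | forall i, B i (Y i w)] = (\prod_i P (B i))%E.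
Proof.
move=> mB; have [idY indY] := iidY.
have := indY [set: 'I_N]%SET B mB.
rewrite (_ : \bigcap_(_ in _) _ = [set w | forall i, B i (Y i w)]); last first.
  apply/seteqP; split => w /= h i; last by move=> _; exact: h.
  by apply: h; rewrite /= finset.in_setT.
move=> ->; apply: eq_big => [i|i _]; first by rewrite finset.in_setT.
by rewrite -(idY i).
Qed.

(** Boxes form a generating pi-system, and on a box both sides are the same product with its factors
    permuted. Involutions cover the two uses: a transposition and the swaps of pairs. *)
Lemma iid_exchangeable (s : 'I_N -> 'I_N) (E : set (N.-tuple (measurableTypeR R))) :
  involutive s -> measurable E ->
  Pr [set w | E [tuple Y i w | i < N]] = Pr [set w | E [tuple Y (s i) w | i < N]].
Proof.
move=> sK mE.
have m1 : measurable_fun setT (fun w => [tuple Y i w | i < N]).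
  by apply: measurable_tuple_of => i; exact: (@measurable_funP _ _ _ _ setT (Y i)).
have m2 : measurable_fun setT (fun w => [tuple Y (s i) w | i < N]).
  by apply: (@measurable_tuple_of _ _ _ _ (fun i => Y (s i))) => i;
    exact: (@measurable_funP _ _ _ _ setT (Y (s i))).
apply: (measure_preimage_unique m1 m2 (@measurable_tuple_rect R N)
  (@tuple_rect_setI R N)) mE.
- by exists (fun=> setT) => //; apply/seteqP; split.
- move=> _ [B mB ->]; rewrite /preimage/=.
  under [in LHS]eq_set do under eq_forall do rewrite tnth_mktuple.
  under [in RHS]eq_set do under eq_forall do rewrite tnth_mktuple.
  rewrite iid_rect// (_ : [set w | _] = [set w | forall i, B (s i) (Y i w)]).
    by rewrite (@iid_rect (fun i => B (s i)))// (reindex_inj (inv_inj sK)).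
  apply/seteqP; split => w /= h i; first by have := h (s i); rewrite sK.
  by have := h (s i); rewrite sK.
Qed.

End Iid.

(** Doob-Dynkin factorisation: the random set becomes a fixed measurable function of the training
    tuple, which can then be evaluated on a permuted sample. *)
Lemma random_set_lift (T : Type) (R : realType) n
    (X : 'I_n -> T -> measurableTypeR R) (S : T -> set R) :
  random_set_measurable X S ->
  exists2 A : set (n.-tuple (measurableTypeR R) * measurableTypeR R),
    measurable A & forall w y, S w y <-> A ([tuple X i w | i < n], y).
Proof.
rewrite /random_set_measurable => mS.
pose h w := [tuple X i w | i < n]; pose f (p : T * R) := (h p.1, p.2).
have XE : g_sigma_preimage X = preimage_set_system setT h
    (@measurable _ (n.-tuple (measurableTypeR R))).
  have -> : @measurable _ (n.-tuple (measurableTypeR R)) =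
      g_sigma_preimage (fun i (t : n.-tuple (measurableTypeR R)) => tnth t i) by [].
  rewrite -g_sigma_preimage_comp; congr (g_sigma_preimage _).
  by apply/funext => i; apply/funext => w /=; rewrite tnth_mktuple.
pose G := [set A `*` B | A in @measurable _ (n.-tuple (measurableTypeR R))
                       & B in (measurable : set (set (measurableTypeR R)))].
have : <<s preimage_set_system setT f G >> [set p | S p.1 p.2].
  apply: smallest_sub mS; first exact: smallest_sigma_algebra.
  move=> _ [A + [B mB <-]]; rewrite XE => -[A' mA' <-].
  apply: sub_sigma_algebra; exists (A' `*` B); first by exists A' => //; exists B.
  by apply/seteqP; split => p /=; rewrite /f/=; tauto.
rewrite g_sigma_preimageE => -[A mA AE].
exists A; first by rewrite measurable_prod_measurableType.
move=> w y; have /(congr1 (fun Z => Z (w, y)))/= := AE.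
by rewrite /setI /= /f/= => E; split => [|H]; [rewrite -E => -[]|rewrite -E].
Qed.
End Measure.

(** * Concentration and unions of intervals *)

Section Chernoff.
Context d (T : measurableType d) (R : realType) (Pr : probability T R).
Variable P : probability (measurableTypeR R) R.

Lemma measure_bigsetU_le (A : finType) (D : {pred A}) (E : A -> set T) :
  (forall a, measurable (E a)) ->
  (Pr (\big[setU/set0]_(a in D) E a) <= \sum_(a in D) Pr (E a))%E.
Proof.
move=> mE.
suff [] : measurable (\big[setU/set0]_(a in D) E a) /\
  (Pr (\big[setU/set0]_(a in D) E a) <= \sum_(a in D) Pr (E a))%E by [].
apply: (big_rec2 (fun X (s : \bar R) => measurable X /\ (Pr X <= s)%E)).
  by rewrite measure0.
move=> a s X _ [mX Xs]; split; first exact: measurableU.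
by apply: le_trans (measureU2 _ (mE a) mX) _; rewrite leeD2l.
Qed.

Lemma iid_comp (I J : finType) (Y : J -> {RV Pr >-> R}) (f : I -> J) :
  injective f -> iid P Y -> iid P (fun i => Y (f i)).
Proof.
move=> fI [idY indY]; split => [i A mA|K B mB]; first exact: idY.
pose B' j := if [pick i | f i == j] is Some i then B i else setT.
have B'f i : B' (f i) = B i.
  rewrite /B'; case: pickP => [i' /eqP/fI ->//|/(_ i)].
  by rewrite eqxx.
have mB' j : measurable (B' j) by rewrite /B'; case: pickP.
have := indY (f @: K)%SET B' mB'.
rewrite big_imset/=; last by move=> i j _ _ /fI.
under eq_bigr do rewrite B'f.
move=> <-; congr (Pr _); apply/seteqP; split => w /= h.
  by move=> j /= /imsetP[i iK ->]; rewrite B'f; exact: h.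
by move=> i iK; rewrite -B'f; apply: h; rewrite /= imset_f.
Qed.

(** From [exp x >= 1 + x] and [(1 + x) * (1 - x + x^2) = 1 + x^3 >= 1]. *)
Lemma expRN_le_quad (x : R) : 0 <= x -> expR (- x) <= 1 - x + x ^+ 2.
Proof.
move=> x0; rewrite expRN -[leRHS]invrK lef_pV2 ?posrE ?expR_gt0//; last first.
  by rewrite invr_gt0; nra.
apply: le_trans (expR_ge1Dx x); rewrite -div1r ler_pdivrMr; last by nra.
have : 0 <= x ^+ 3 by rewrite exprn_ge0.
have -> : (1 + x) * (1 - x + x ^+ 2) = 1 + x ^+ 3 by ring.
lra.
Qed.

(** Splitting the event by the set [J] of observations that fall in [C] makes the exponential moment
    a finite sum, which factorises over the observations. *)
Lemma chernoff n (Y : 'I_n -> {RV Pr >-> R}) (C : set R) (dl : R) :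
  iid P Y -> measurable C -> 0 <= dl ->
  (Pr [set w | \sum_(i < n) \1_C (Y i w) < n%:R * (fine (P C) - dl)]%R
     <= (expR (- (n%:R * dl ^+ 2 / 4)))%:E)%E.
Proof.
move=> iidY mC dl0.
set p := fine (P C); set s := n%:R * (p - dl).
have PC : P C = p%:E by rewrite fineK//; exact: fin_num_measure.
have PCc : P (~` C) = (1 - p)%:E by rewrite probability_setC// PC.
have p0 : 0 <= p by rewrite -lee_fin -PC measure_ge0.
have p1 : p <= 1 by rewrite -lee_fin -PC probability_le1.
pose B (J : {ffun 'I_n -> bool}) i := if J i then C else ~` C.
pose E J := [set w | forall i, B J i (Y i w)].
have mB J i : measurable (B J i) by rewrite /B; case: ifP => // _; exact: measurableC.
have mE J : measurable (E J).
  rewrite (_ : E J = \bigcap_(i in [set: 'I_n]) (Y i @^-1` B J i)).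
    apply: fin_bigcap_measurable => [|i _]; first exact: finite_finset.
    rewrite -[X in measurable X]setTI.
    exact: (@measurable_funP _ _ _ _ setT (Y i) measurableT _ (mB J i)).
  by apply/seteqP; split => w /= h i; [move=> _; exact: h|exact: (h i I)].
pose D := [pred J : {ffun 'I_n -> bool} | (\sum_i (J i)%:R : R) < s].
have -> : [set w | \sum_(i < n) \1_C (Y i w) < s] = \big[setU/set0]_(J in D) E J.
  rewrite -bigcup_seq_cond; apply/seteqP; split => w /=.
    move=> h; exists [ffun i => `[< C (Y i w) >]].
      rewrite /= mem_index_enum inE; apply: le_lt_trans h; apply: ler_sum => i _.
      rewrite ffunE indicE.
      by case: asboolP => Cw; [rewrite mem_set|rewrite memNset].
    by move=> i; rewrite /B ffunE; case: asboolP.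
  move=> [J /andP[_]]; rewrite inE => h EJ; apply: le_lt_trans h.
  apply: ler_sum => i _; have := EJ i; rewrite /B indicE.
  by case: (J i) => /= h; [rewrite mem_set|rewrite memNset].
apply: le_trans (measure_bigsetU_le _ mE) _.
(* The final exponent is [- n * (l * dl - l^2)], smallest at this [l]. *)
pose l := dl / 2.
pose g (b : bool) : R := if b then p * expR (- l) else 1 - p.
have -> : (\sum_(J in D) Pr (E J) =
    (\sum_(J in D) \prod_i (if J i then p else 1 - p))%:E)%E.
  rewrite -sumEFin; apply: eq_bigr => J _; rewrite (iid_rect iidY)// -prodEFin.
  by apply: eq_bigr => i _; rewrite /B; case: (J i).
rewrite lee_fin.
have l0 : 0 <= l by rewrite /l; lra.
apply: (@le_trans _ _ (expR (l * s) * \sum_(J : {ffun 'I_n -> bool}) \prod_i g (J i))).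
  rewrite mulr_sumr big_mkcond/=; apply: ler_sum => J _.
  have q0 : 0 <= \prod_i (if J i then p else 1 - p).
    by apply: prodr_ge0 => i _; case: (J i) => //; lra.
  have -> : \prod_i g (J i) =
      expR (- (l * \sum_i (J i)%:R)) * \prod_i (if J i then p else 1 - p).
    rewrite mulr_sumr -sumrN expR_sum -big_split/=; apply: eq_bigr => i _.
    by rewrite /g; case: (J i); rewrite ?mulr1 ?mulr0 ?oppr0 ?expR0 ?mul1r// mulrC.
  rewrite mulrA -expRD -mulrBr; case: ifPn => [|_]; last first.
    by rewrite mulr_ge0 ?expR_ge0.
  rewrite inE => Js; rewrite ler_peMl//; apply: le_trans (expR_ge1Dx _).
  by rewrite lerDl mulr_ge0// subr_ge0 ltW.
rewrite -(bigA_distr_bigA (fun _ b => g b)) prodr_const card_ord big_bool/=.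
have h : p * expR (- l) + (1 - p) <= expR (- (p * l) + l ^+ 2).
  apply: le_trans (expR_ge1Dx _).
  have := expRN_le_quad l0 => /(ler_wpM2l p0).
  have := sqr_ge0 l; nra.
apply: (@le_trans _ _ (expR (l * s) * expR (- (p * l) + l ^+ 2) ^+ n)).
  rewrite ler_pM2l ?expR_gt0//; apply: lerXn2r => //; rewrite nnegrE ?expR_ge0//.
  by rewrite addr_ge0 ?mulr_ge0 ?expR_ge0//; lra.
rewrite -expRM_natl -expRD ler_expR /s /l le_eqVlt; apply/orP; left; apply/eqP.
by field.
Qed.
End Chernoff.

(** * Traces of unions of intervals, and order statistics *)

Section Intervals.
Variable R : realType.

Definition sample_intervals (J : finType) (y : J -> R) (D : {set J * J}) :=
  [seq (y c.1, y c.2) | c <- enum D].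

(** Each interval that meets the sample is replaced by the closed interval between its extreme
    sample points. Endpoints given by indices leave finitely many candidates. *)
Lemma interval_unions_trace (J : finType) (y : J -> R) k (C : set R) :
  interval_unions k C -> exists2 D : {set J * J}, (#|D| <= k)%N &
    forall x, in_intervals (sample_intervals y D) (y x) = (y x \in C).
Proof.
move=> [I ->].
pose A j x := y x \in I j.
pose D j : {set J * J} := if [pick x | A j x] is Some x0 then
  [set ([arg min_(x < x0 | A j x) y x], [arg max_(x > x0 | A j x) y x])%O]%SET
  else finset.set0.
exists (\bigcup_j D j)%SET.
  have : (\sum_(j < k) #|D j| <= k)%N.
    rewrite -[leqRHS](card_ord k) -sum1_card leq_sum// => j _.
    by rewrite /D; case: pickP => [x0|] _; rewrite ?cards1 ?cards0.
  by apply: leq_trans; exact: (leq_card_bigcup xpredT).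
move=> x; apply/idP/idP.
  move=> /hasP[_ /mapP[[a b] + ->] /= yab].
  rewrite mem_enum => /finset.bigcupP[j _]; rewrite /D.
  case: pickP => [x0 x0A|_]; last first.
    by rewrite finset.in_set0.
  rewrite inE => /eqP[aE bE]; move: yab; rewrite aE bE.
  case: arg_minP => // a' Aa' _; case: arg_maxP => // b' Ab' _ yab.
  apply/mem_set; exists j => //.
  exact: (interval_is_interval Aa' Ab' yab).
move=> /set_mem[j _ /= xj].
have [x0 x0A Dj] : exists2 x0, A j x0 &
  D j = [set ([arg min_(z < x0 | A j z) y z], [arg max_(z > x0 | A j z) y z])%O]%SET.
  rewrite /D; case: pickP => [x0 x0A|/(_ x)]; first by exists x0.
  by rewrite /A xj.
apply/hasP.
exists (y [arg min_(z < x0 | A j z) y z]%O, y [arg max_(z > x0 | A j z) y z]%O).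
  apply/mapP.
  exists ([arg min_(z < x0 | A j z) y z], [arg max_(z > x0 | A j z) y z])%O => //.
  rewrite mem_enum; apply/finset.bigcupP; exists j => //.
  by rewrite Dj inE.
rewrite /=; case: arg_minP => // a _ amin; case: arg_maxP => // b _ bmax.
by rewrite amin//=; exact: bmax.
Qed.

Lemma interval_unions_measurable k (C : set R) :
  interval_unions k C -> measurable (C : set (measurableTypeR R)).
Proof.
move=> [I ->]; apply: fin_bigcup_measurable => [|i _]; first exact: finite_finset.
exact: measurable_itv.
Qed.

Lemma order_stat_le (s : seq R) r x : (0 < r <= size s)%N ->
  (order_stat s r <= x) = (r <= count (fun z => (z <= x)%R) s)%N.
Proof.
case/andP => r0 rs; rewrite /order_stat.
set t := sort _ s.
have pt : perm_eq t s by rewrite /t perm_sort.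
rewrite -(seq.permP pt) -(perm_size pt) in rs *.
have st : sorted <=%R t by apply: sort_sorted; exact: le_total.
have nm a b : (a <= b)%N -> (b < size t)%N -> t`_a <= t`_b.
  move=> ab bt; apply: (sorted_leq_nth (@le_trans _ _) (@lexx _ _) 0 st) => //.
  by rewrite inE (leq_ltn_trans ab).
have r1 : (r.-1 < size t)%N by rewrite prednK.
apply/idP/idP => h.
  rewrite -(cat_take_drop r t) count_cat.
  apply: leq_trans (leq_addr _ _).
  rewrite (_ : count _ (take r t) = r)//.
  rewrite -[RHS](size_takel rs); apply/eqP; rewrite -all_count.
  apply/(all_nthP 0) => i; rewrite size_takel// => ir; rewrite nth_take//.
  by apply: le_trans h; apply: nm => //; rewrite -ltnS prednK.
rewrite leNgt; apply/negP => xt.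
suff : (count (fun z => (z <= x)%R) t <= r.-1)%N by
  move/(leq_trans h); rewrite leqNgt prednK ?leqnn.
rewrite -(cat_take_drop r.-1 t) count_cat.
rewrite (_ : count _ (drop _ _) = 0%N); last first.
  apply/eqP; rewrite -leqn0 leqNgt -has_count; apply/negP => /(has_nthP 0)[i].
  rewrite size_drop nth_drop => it; apply/negP; rewrite -ltNge.
  by apply: lt_le_trans xt _; apply: nm; [exact: leq_addr|rewrite -ltn_subRL].
by rewrite addn0; apply: leq_trans (count_size _ _) _; rewrite size_takel// ltnW.
Qed.
End Intervals.

(** * Coverage *)

Section Score.
Variable R : realType.

Lemma cpdp_setE n m (alpha : R) (S : 'I_m -> set R) (y : 'I_n -> R) z :
  (0 < Num.truncn (n.+1%:R * alpha) <= n)%N ->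
  cpdp_set alpha S y z <-> (Num.truncn (n.+1%:R * alpha) <=
     #|[set i | (score S (y i) <= score S z)%R]%SET|)%N.
Proof.
move=> rn; rewrite /cpdp_set/= order_stat_le; last by rewrite size_map size_enum_ord.
rewrite count_map -sum1_count big_enum_cond/=.
by rewrite (_ : #|_| = \sum_(i | (score S (y i) <= score S z)%R) 1)%N ?sum1dep_card.
Qed.

(** By nesting, a point outside [S js] scores strictly less than every point inside. The calibration
    points scoring no more than it thus all lie outside [S js], and fewer than the required rank
    do. *)
Lemma cpdp_subset n m (alpha : R) (S : 'I_m -> set R) (y : 'I_n -> R) js :
  (forall i j : 'I_m, (i <= j)%N -> S i `<=` S j) ->
  (0 < Num.truncn (n.+1%:R * alpha) <= n)%N ->
  (n < Num.truncn (n.+1%:R * alpha) + #|[set i | y i \in S js]%SET|)%N ->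
  cpdp_set alpha S y `<=` S js.
Proof.
move=> Snest rn nr z /(cpdp_setE _ _ _ rn) rz.
apply: contrapT => zS; move: nr; apply/negP; rewrite -leqNgt.
apply: (@leq_trans (#|~: [set i | y i \in S js]%SET|%SET
  + #|[set i | y i \in S js]%SET|)%N); last first.
  by rewrite addnC cardsC card_ord.
rewrite leq_add2r; apply: leq_trans rz _; apply/subset_leq_card/fintype.subsetP => i.
rewrite !inE => yz; apply: contraL yz => /set_mem yS; rewrite -ltNge.
rewrite /score (bigD1 js)//= [ltRHS](bigD1 js)//=.
rewrite !indicE memNset// mem_set// ltr_leD//.
apply: ler_sum => j _; rewrite !indicE.
have [jj|/ltnW jj] := leqP j js.
  by rewrite memNset// => zj; apply: zS; exact: (Snest _ _ jj).
have -> : y i \in S j by apply/mem_set; exact: (Snest _ _ jj).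
by rewrite ler_nat leq_b1.
Qed.

(** The element of largest value among those counted has all the others below it, yet at most [r]
    elements are below it. *)
Lemma card_low_rank (I : finType) (J : {set I}) (v : I -> R) r :
  (#|[set j in J | #|[set i in J | (v i <= v j)%R]| <= r]| <= r)%SET%N.
Proof.
set L := finset _.
have [->|[j0 j0L]] := set_0Vmem L; first by rewrite cards0.
have := j0L; rewrite inE => /andP[_ _].
pose j1 := [arg max_(j > j0 in L) v j]%O.
have [j1L j1max] : j1 \in L /\ forall j, j \in L -> v j <= v j1.
  by rewrite /j1; case: arg_maxP.
have := j1L; rewrite inE => /andP[_]; apply: leq_trans.
apply/subset_leq_card/fintype.subsetP => j jL; rewrite inE j1max// andbT.
by move: jL; rewrite inE => /andP[].
Qed.

End Score.

Section Coverage.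
Context d (T : measurableType d) (R : realType) (Pr : probability T R).
Variables (P : probability (measurableTypeR R) R) (n m : nat).
Variable Y : 'I_(n + n + 1) -> {RV Pr >-> R}.
Hypothesis iidY : iid P Y.
Variable S : 'I_m -> T -> set R.
Hypothesis mS : forall j, random_set_measurable (fun i => Y (train_idx i)) (S j).

Let N := (n + n + 1)%N.
Let J : {set 'I_N} := [set j : 'I_N | (n <= j)%N]%SET.

Definition train_tuple (t : (n + n + 1).-tuple (measurableTypeR R)) :
  n.-tuple (measurableTypeR R) := [tuple tnth t (train_idx i) | i < n].

Lemma measurable_train_pair (j : 'I_(n + n + 1)) :
  measurable_fun setT (fun t : (n + n + 1).-tuple (measurableTypeR R) =>
    (train_tuple t, tnth t j)).
Proof.
apply: measurable_fun_pair; last exact: measurable_tnth.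
by apply: measurable_tuple_of => i; exact: measurable_tnth.
Qed.

Lemma big_calib_test (Q : 'I_(n + n + 1) -> nat) :
  (\sum_(j in J) Q j = \sum_(i < n) Q (calib_idx i) + Q (test_idx n))%N.
Proof.
rewrite big_mkcond/= !big_split_ord/= big_ord1.
rewrite [X in (X + _ + _)%N]big1 => [|i _]; last first.
  by rewrite inE /= leqNgt ltn_ord.
rewrite add0n inE /= addn0 leq_addr; congr (_ + _)%N.
by apply: eq_bigr => i _; rewrite inE /= leq_addr.
Qed.

Lemma coverage r (F := [set w | (#|[set i : 'I_n |
      (score (S^~ w) (Y (calib_idx i) w)
         <= score (S^~ w) (Y (test_idx n) w))%R]%SET| < r)%N]) :
  measurable F /\ (n.+1%:R%:E * Pr F <= r%:R%:E)%E.
Proof.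
have /choice[A AP] : forall j,
    exists A : set (n.-tuple (measurableTypeR R) * measurableTypeR R),
    measurable A /\ forall w y, S j w y <-> A ([tuple Y (train_idx i) w | i < n], y).
  by move=> j; have [A mA AE] := random_set_lift (mS j); exists A.
pose V (t : N.-tuple (measurableTypeR R)) (j : 'I_N) : R :=
  \sum_l (`[< A l (train_tuple t, tnth t j) >])%:R.
(* The point [j] counts itself here, so [<= r] corresponds to [< r] in [F]. *)
pose E j := [set t | (#|[set i in J | (V t i <= V t j)%R]%SET| <= r)%N].
have mE j : measurable (E j).
  pose Q (a : 'I_m * 'I_N) t := `[< A a.1 (train_tuple t, tnth t a.2) >].
  pose Phi (p : {set 'I_m * 'I_N}) : bool := (#|[set i in J |
    ((\sum_l ((l, i) \in p)%:R : R) <= \sum_l ((l, j) \in p)%:R)%R]%SET| <= r)%N.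
  rewrite (_ : E j = [set t | Phi [set a | Q a t]%SET]).
    apply: (@measurable_pattern _ _ _ Q Phi) => -[l i].
    rewrite (_ : [set t | _] = (fun t => (train_tuple t, tnth t i)) @^-1` (A l)).
      rewrite -[X in measurable X]setTI; apply: measurable_train_pair => //.
      exact: (AP l).1.
    by apply/seteqP; split => t /= /asboolP.
  suff PE t : Phi [set a | Q a t]%SET =
      (#|[set i in J | (V t i <= V t j)%R]%SET| <= r)%N.
    by apply/seteqP; split => t; rewrite /E /= PE.
  rewrite /Phi; congr (_ <= r)%N; apply: eq_card => i; rewrite !inE.
  by congr (_ && (_ <= _)); apply: eq_bigr => l _; rewrite inE.
pose tY w : N.-tuple (measurableTypeR R) := [tuple Y i w | i < N].
have mtY j : measurable (tY @^-1` E j).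
  rewrite -[X in measurable X]setTI; apply: measurable_tuple_of => // i.
  exact: (@measurable_funP _ _ _ _ setT (Y i)).
(* The transposition of [j] and the test index fixes the training indices, hence the score function,
   and exchanges the two ranks. *)
have nJ j : j \in J -> Pr (tY @^-1` E j) = Pr (tY @^-1` E (test_idx n)).
  move=> jJ.
  pose s x := if x == j then test_idx n else if x == test_idx n then j else x.
  have sK : involutive s.
    move=> x; rewrite /s; case: (eqVneq x j) => [->|xj].
      by rewrite eqxx; case: eqVneq => [->//|_].
    by case: (eqVneq x (test_idx n)) => [->|xt];
      rewrite ?eqxx ?(negbTE xj) ?(negbTE xt).
  have tJ : test_idx n \in J by rewrite inE /= addn0 leq_addr.
  have sJ x : (s x \in J) = (x \in J).
    by rewrite /s; case: eqP => [->|_]; [rewrite tJ jJ|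
      case: eqP => [->|//]; rewrite tJ jJ].
  have sN x : (n <= s x)%N = (n <= x)%N by have := sJ x; rewrite !inE.
  have st i : s (train_idx i) = train_idx i.
    have tiJ : train_idx i \notin J by rewrite inE /= -ltnNge ltn_ord.
    rewrite /s; case: eqP => [tj|_]; first by rewrite tj jJ in tiJ.
    by case: eqP => [tt|//]; rewrite tt tJ in tiJ.
  rewrite [RHS](iid_exchangeable iidY sK (mE _)); congr (Pr _).
  have VE w x : V [tuple Y (s i) w | i < N] x = V (tY w) (s x).
    apply: eq_bigr => l _.
    rewrite (_ : train_tuple _ = train_tuple (tY w)) ?tnth_mktuple//.
    by apply: eq_from_tnth => i; rewrite !tnth_mktuple st.
  have sE : s (test_idx n) = j by rewrite /s eqxx; case: eqP.
  suff cE w : #|[set i in J | (V [tuple Y (s i) w | i < N] i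
        <= V [tuple Y (s i) w | i < N] (test_idx n))%R]%SET|
      = #|[set i in J | (V (tY w) i <= V (tY w) j)%R]%SET|.
    by apply/seteqP; split => w; rewrite /E /= cE.
  rewrite -(card_imset _ (inv_inj sK)); apply: eq_card => i.
  by rewrite -[i in LHS]sK (mem_imset _ _ (inv_inj sK)) !inE sN !VE sK sE.
rewrite (_ : F = tY @^-1` E (test_idx n)); last first.
  have VE w j : V (tY w) j = score (S^~ w) (Y j w).
    apply: eq_bigr => l _; rewrite indicE; congr (_%:R).
    have tE : (train_tuple (tY w), tnth (tY w) j) =
        ([tuple Y (train_idx i) w | i < n], Y j w).
      congr (_, _); rewrite ?tnth_mktuple//.
      by apply: eq_from_tnth => i; rewrite !tnth_mktuple.
    rewrite tE; congr nat_of_bool.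
    by apply/asboolP/idP => [/(AP l).2/mem_set//|/set_mem/(AP l).2//].
  suff cE w : #|[set i in J | (V (tY w) i <= V (tY w) (test_idx n))%R]%SET| =
    #|[set i : 'I_n | (score (S^~ w) (Y (calib_idx i) w)
        <= score (S^~ w) (Y (test_idx n) w))%R]%SET|.+1.
    by apply/seteqP; split => w; rewrite /E /F /= cE.
  rewrite -[LHS]sum1_card.
  rewrite (eq_bigl (fun i => (i \in J) && (V (tY w) i <= V (tY w) (test_idx n)))).
    rewrite big_mkcondr/= big_calib_test lexx addn1 -big_mkcond/= sum1dep_card.
    by congr _.+1; apply: eq_card => i; rewrite !inE !VE.
  by move=> i; rewrite inE.
split; first exact: mtY.
have : (\sum_(j in J) Pr (tY @^-1` E j) <= r%:R%:E)%E.
  rewrite big_mkcond/=.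
  rewrite (eq_bigr (fun j => Pr (if j \in J then tY @^-1` E j else set0))); last first.
    by move=> j _; case: ifP => //; rewrite measure0.
  apply: sum_measure_le => [j|w]; first by case: ifP.
  rewrite ler_nat; apply: leq_trans (card_low_rank J (V (tY w)) r).
  apply/subset_leq_card/fintype.subsetP => j; rewrite !inE.
  by case: ifP => // _ /asboolP.
rewrite (eq_bigr _ nJ) -(fineK (fin_num_measure Pr _ (mtY (test_idx n)))).
rewrite sumEFin -EFinM !lee_fin sumr_const.
rewrite (_ : #|_| = n.+1); last first.
  by rewrite -sum1_card big_calib_test sum1_card card_ord addn1.
by rewrite mulr_natl.
Qed.

End Coverage.

(** * Uniform deviation between the two halves of the sample *)

Section Deviation.
Context d (T : measurableType d) (R : realType) (Pr : probability T R).
Variables (P : probability (measurableTypeR R) R) (n : nat).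
Variable Y : 'I_(n + n + 1) -> {RV Pr >-> R}.
Hypothesis iidY : iid P Y.

Definition pair_idx (x : bool * 'I_n) : 'I_(n + n + 1) :=
  if x.1 then calib_idx x.2 else train_idx x.2.

(** Exchanges the [i]-th training and calibration points when [e i] holds; the test index lies in no
    pair and stays fixed. *)
Definition pair_swap (e : {ffun 'I_n -> bool}) (j : 'I_(n + n + 1)) : 'I_(n + n + 1) :=
  if [pick x | pair_idx x == j] is Some x then pair_idx (x.1 (+) e x.2, x.2) else j.

Lemma pair_idx_inj : injective pair_idx.
Proof.
move=> [b i] [c j] /(congr1 val); have := ltn_ord i; have := ltn_ord j.
case: b; case: c => /= ji ii h; try by exfalso; lia.
  by congr pair; apply: ord_inj; lia.
by congr pair; apply: ord_inj.
Qed.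

Lemma pair_swap_idx e b i : pair_swap e (pair_idx (b, i)) = pair_idx (b (+) e i, i).
Proof.
rewrite /pair_swap; case: pickP => [x /eqP/pair_idx_inj->//|/(_ (b, i))].
by rewrite eqxx.
Qed.

Lemma pair_swapK e : involutive (pair_swap e).
Proof.
move=> j; case: (pickP (fun x => pair_idx x == j)) => [[b i] /eqP <-|jN].
  by rewrite !pair_swap_idx addbK.
have o : pair_swap e j = j by rewrite /pair_swap; case: pickP => [x|//]; rewrite jN.
by rewrite !o.
Qed.

(** Symmetrisation with the calibration half as ghost sample: the bad event has the same probability
    after every swap [e], and for each outcome [card_discrepancy] bounds the number of [e] that make
    it bad. *)
Lemma uniform_deviation k (u t : R) :
  (0 < n)%N -> (0 < k <= n)%N -> 0 <= u -> 0 <= t ->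
  64 * n%:R * (4 * k%:R + u) <= t ^+ 2 ->
  exists2 B : set T, measurable B /\ (Pr B <= ((4 * n)%:R * expR (- u))%:E)%E &
    forall w C, ~ B w -> interval_unions k C ->
      \sum_(i < n) \1_C (Y (train_idx i) w) - \sum_(i < n) \1_C (Y (calib_idx i) w)
        <= 9 * t.
Proof.
move=> n0 k0n u0 t0 ht.
pose X := (bool * 'I_n)%type; pose N := (n + n + 1)%N.
pose ind (s : N.-tuple (measurableTypeR R)) (D : {set X * X}) x : bool :=
  [exists c in D, (tnth s (pair_idx c.1) <= tnth s (pair_idx x))
               && (tnth s (pair_idx x) <= tnth s (pair_idx c.2))].
have indE s D x : ind s D x = in_intervals
    (sample_intervals (fun x => tnth s (pair_idx x)) D) (tnth s (pair_idx x)).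
  apply/exists_inP/hasP => [[c cD h]|[_ /mapP[c cD ->] h]].
    exists (tnth s (pair_idx c.1), tnth s (pair_idx c.2)) => //.
    by apply/mapP; exists c => //; rewrite mem_enum.
  by exists c => //; rewrite -mem_enum.
pose F := [set s : N.-tuple (measurableTypeR R) |
  exists2 D : {set X * X}, (#|D| <= k)%N &
   9 * t < \sum_i ((ind s D (false, i))%:R - (ind s D (true, i))%:R)].
have mF : measurable F.
  (* [F] depends on the sample only through the comparisons between its points. *)
  pose Q (c : X * X) (s : N.-tuple (measurableTypeR R)) : bool :=
    tnth s (pair_idx c.1) <= tnth s (pair_idx c.2).
  pose ind' (p : {set X * X}) (D : {set X * X}) x : bool :=
    [exists c in D, ((c.1, x) \in p) && ((x, c.2) \in p)].
  pose Phi p := exists2 D : {set X * X}, (#|D| <= k)%N &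
    9 * t < \sum_i ((ind' p D (false, i))%:R - (ind' p D (true, i))%:R).
  have ind'E s D x : ind s D x = ind' [set c | Q c s]%SET D x.
    by apply: eq_existsb => c; rewrite !inE.
  rewrite (_ : F = [set s | Phi [set c | Q c s]%SET]).
    apply: (@measurable_pattern _ _ _ Q Phi) => -[a b].
    have := @measurable_fun_le _ _ R setT
      (fun s : N.-tuple (measurableTypeR R) => tnth s (pair_idx a))
      (fun s => tnth s (pair_idx b)) measurableT (measurable_tnth _) (measurable_tnth _).
    by rewrite setTI.
  apply/seteqP; split => s [D Dk h]; exists D => //; move: h.
    by under eq_bigr do rewrite !ind'E.
  by under [X in _ < X -> _]eq_bigr do rewrite -!ind'E.
pose tY w : N.-tuple (measurableTypeR R) := [tuple Y i w | i < N].
pose sY e w : N.-tuple (measurableTypeR R) := [tuple Y (pair_swap e i) w | i < N].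
have mtY : measurable (tY @^-1` F).
  rewrite -[X in measurable X]setTI; apply: measurable_tuple_of => // i.
  exact: (@measurable_funP _ _ _ _ setT (Y i)).
have msY e : measurable (sY e @^-1` F).
  rewrite -[X in measurable X]setTI.
  apply: (@measurable_tuple_of _ _ _ _ (fun i => Y (pair_swap e i))) => // i.
  exact: (@measurable_funP _ _ _ _ setT (Y (pair_swap e i))).
exists (tY @^-1` F); first split => //.
  have : (\sum_(e : {ffun 'I_n -> bool}) Pr (sY e @^-1` F) <=
      (2 ^+ n * ((4 * n)%:R * expR (- u)))%:E)%E.
    apply: sum_measure_le => // w.
    apply: le_trans (card_discrepancy (fun x => Y (pair_idx x) w) n0 k0n u0 t0 ht).
    rewrite ler_nat; apply/subset_leq_card/fintype.subsetP => e; rewrite !inE.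
    move=> [D Dk h].
    exists (sample_intervals (fun x => tnth (sY e w) (pair_idx x)) D).
      by rewrite size_map -cardE.
    (* Swapping a pair changes the sign of its difference. *)
    apply: (lt_le_trans h); rewrite le_eqVlt; apply/orP; left; apply/eqP.
    apply: eq_bigr => i _.
    rewrite !indE !tnth_mktuple !pair_swap_idx addFb addTb.
    by case: (e i); rewrite ?expr1 ?expr0 ?mulN1r ?opprB ?mul1r.
  rewrite (eq_bigr (fun=> Pr (tY @^-1` F))); last first.
    by move=> e _; rewrite [RHS](iid_exchangeable iidY (@pair_swapK e) mF).
  rewrite -(fineK (fin_num_measure Pr _ mtY)) sumEFin !lee_fin sumr_const.
  rewrite card_ffun card_bool card_ord -(mulr_natl (fine _)) natrX.
  by rewrite ler_pM2l// exprn_gt0.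
move=> w C nF Ck; rewrite leNgt; apply/negP => h; apply: nF.
have [D Dk DE] := interval_unions_trace (fun x => Y (pair_idx x) w) Ck.
exists D => //; apply: (lt_le_trans h); rewrite -sumrB.
have tE : (fun x => tnth (tY w) (pair_idx x)) = (fun x => Y (pair_idx x) w).
  by apply/funext => x; rewrite tnth_mktuple.
apply: ler_sum => i _; rewrite !indE tE !tnth_mktuple.
rewrite (DE (false, i)) (DE (true, i)).
by rewrite !indicE.
Qed.
End Deviation.

(** * Volume optimality *)

Section Assembly.
Variable R : realType.

Lemma empiricalE n (y : 'I_n -> R) (A : set R) :
  empirical y A = (n%:R^-1 * \sum_(i < n) \1_A (y i))%:E.
Proof.
by rewrite /empirical EFinM -sumEFin.
Qed.

(** Squaring gives [n * delta^2 >= 10000 * (k + ln n)], whence all items. The third and fourth serve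
    [uniform_deviation] with [u = 2 * ln n] and [t = delta * n / 3], so that
    [9 * t = 3 * delta * n]; the last serves [chernoff]. *)
Lemma rate_consequences (n k : nat) (delta : R) : (0 < n)%N -> (0 < k)%N ->
  0 < delta -> 3 * delta < 1 ->
  100 * Num.sqrt ((k%:R + ln n%:R) / n%:R) <= delta ->
  [/\ (k <= n)%N, 0 <= ln n%:R :> R,
      64 * n%:R * (4 * k%:R + 2 * ln n%:R) <= (delta * n%:R / 3) ^+ 2,
      (4 * n)%:R * expR (- (2 * ln n%:R)) <= delta
    & expR (- (n%:R * delta ^+ 2 / 4)) <= delta].
Proof.
move=> n0 k0 d0 d1 h.
have nR : 0 < n%:R :> R by rewrite ltr0n.
have k1 : 1 <= k%:R :> R by rewrite ler1n.
have l0 : 0 <= ln n%:R :> R by apply: ln_ge0; rewrite ler1n.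
have h2 : 10000 * (k%:R + ln n%:R) <= n%:R * delta ^+ 2.
  have : (100 * Num.sqrt ((k%:R + ln n%:R) / n%:R)) ^+ 2 <= delta ^+ 2.
    by apply: lerXn2r => //; rewrite nnegrE ?mulr_ge0 ?sqrtr_ge0 ?ltW.
  rewrite exprMn sqr_sqrtr; last by rewrite divr_ge0 ?addr_ge0.
  rewrite mulrA ler_pdivrMr// => h2; rewrite [leRHS]mulrC; apply: le_trans h2.
  by rewrite ler_wpM2r//; [rewrite addr_ge0|rewrite -natrX ler_nat].
have dn : 10000 <= n%:R * delta.
  apply: (@le_trans _ _ (n%:R * delta ^+ 2)); first by lra.
  by rewrite ler_wpM2l ?(ltW nR)// expr2 ler_piMr ?(ltW d0)//; lra.
have nd : n%:R^-1 <= delta by rewrite -div1r ler_pdivrMr// mulrC; lra.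
have en : expR (- ln n%:R) = n%:R^-1 :> R by rewrite expRN lnK// posrE.
split => //.
- rewrite -(ler_nat R); have : n%:R * delta ^+ 2 <= n%:R.
    by rewrite -[leRHS]mulr1 ler_wpM2l ?(ltW nR)// expr_le1 ?ltW//; lra.
  lra.
- have -> : (delta * n%:R / 3) ^+ 2 = n%:R * (n%:R * delta ^+ 2 / 9) by field.
  rewrite (_ : 64 * _ * (4 * _ + _) = n%:R * (64 * (4 * k%:R + 2 * ln n%:R)));
    last by ring.
  by rewrite ler_pM2l//; lra.
- rewrite (_ : - (2 * ln n%:R) = - ln n%:R + - ln n%:R); last by ring.
  rewrite expRD en natrM (_ : _ * _ = 4 / n%:R); last by field; rewrite gt_eqF.
  by rewrite ler_pdivrMr// mulrC; lra.
- by apply: le_trans nd; rewrite -en ler_expR lerN2; lra.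
Qed.

(** The rank must lie between 1 and [n], so that [order_stat] is a true order statistic and not a
    default value. *)
Lemma rank_bounds (n : nat) (alpha : R) : (0 < n)%N -> 0 < alpha < 1 ->
  n%:R^-1 <= alpha ->
  [/\ (0 < Num.truncn (n.+1%:R * alpha) <= n)%N,
      (Num.truncn (n.+1%:R * alpha))%:R <= n.+1%:R * alpha
    & n.+1%:R * alpha < (Num.truncn (n.+1%:R * alpha)).+1%:R].
Proof.
move=> n0 /andP[a0 a1] na.
have nR : 0 < n%:R :> R by rewrite ltr0n.
have x0 : 0 <= n.+1%:R * alpha by rewrite mulr_ge0// ltW.
have /andP[r1 r2] := truncn_itv x0.
have n1 : 1 <= n.+1%:R * alpha.
  have : n%:R * n%:R^-1 <= n%:R * alpha by rewrite ler_pM2l.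
  by rewrite mulfV ?gt_eqF// -natr1; nra.
split => //; apply/andP; split.
  by rewrite -ltnS -(ltr_nat R); apply: le_lt_trans r2.
rewrite -ltnS -(ltr_nat R); apply: le_lt_trans r1 _.
by rewrite -[ltRHS]mulr1 ltr_pM2l// ltr0n.
Qed.

End Assembly.

(** * Measurability of the conformal set, and passage to the infimum *)

Section RandomSets.
Context d (T : measurableType d) (R : realType) (Pr : probability T R).

Lemma random_set_graph n (X : 'I_n -> {RV Pr >-> R}) (S : T -> set R) :
  random_set_measurable (fun i => X i) S ->
  measurable [set p : T * measurableTypeR R | S p.1 p.2].
Proof.
move=> /random_set_lift[A mA AE].
rewrite (_ : [set p | _] = (fun p : T * measurableTypeR R =>
  ([tuple X i p.1 | i < n] : n.-tuple (measurableTypeR R), p.2)) @^-1` A).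
  rewrite -[X in measurable X]setTI.
  have mp : measurable_fun setT (fun p : T * measurableTypeR R =>
    ([tuple X i p.1 | i < n] : n.-tuple (measurableTypeR R), p.2)).
    apply: measurable_fun_pair => //.
    apply: (@measurable_tuple_of _ _ _ _ (fun i p => X i p.1)) => i.
    apply: measurableT_comp => //; exact: (@measurable_funP _ _ _ _ setT (X i)).
  exact: mp.
by apply/seteqP; split => -[w z] /= /AE.
Qed.

(** A measurable graph makes the volume a measurable function of the outcome. Membership depends on
    finitely many answers; in [Q], [None] stands for the candidate point. *)
Lemma cpdp_graph n m N (X : 'I_N -> {RV Pr >-> R}) (Z : 'I_n -> {RV Pr >-> R})
    (S : 'I_m -> T -> set R) alpha :
  (0 < Num.truncn (n.+1%:R * alpha) <= n)%N ->
  (forall j, random_set_measurable (fun i => X i) (S j)) ->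
  measurable [set p : T * measurableTypeR R |
    cpdp_set alpha (S^~ p.1) (fun i => Z i p.1) p.2].
Proof.
move=> rn mS.
pose Q (a : 'I_m * option 'I_n) (p : T * measurableTypeR R) :=
  `[< S a.1 p.1 (if a.2 is Some i then Z i p.1 else p.2) >].
pose sc (s : {set 'I_m * option 'I_n}) o : R := \sum_l ((l, o) \in s)%:R.
pose Phi s : bool := (Num.truncn (n.+1%:R * alpha) <=
   #|[set i | (sc s (Some i) <= sc s None)%R]%SET|)%N.
rewrite (_ : [set p | _] = [set p | Phi [set a | Q a p]%SET]).
  apply: (@measurable_pattern _ _ _ Q Phi) => -[l [i|]].
    rewrite (_ : [set x | _] = (fun p : T * measurableTypeR R =>
       (p.1, Z i p.1 : measurableTypeR R)) @^-1` [set p | S l p.1 p.2]).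
      have mp : measurable_fun setT (fun p : T * measurableTypeR R =>
         (p.1, Z i p.1 : measurableTypeR R)).
        apply: measurable_fun_pair => //.
        apply: measurableT_comp => //; exact: (@measurable_funP _ _ _ _ setT (Z i)).
      rewrite -[X in measurable X]setTI; apply: mp => //.
      exact: random_set_graph (mS l).
    by apply/seteqP; split => p /= /asboolP.
  rewrite (_ : [set x | _] = [set p | S l p.1 p.2]);
    first exact: random_set_graph (mS l).
  by apply/seteqP; split => p /= /asboolP.
have PE p : Phi [set a | Q a p]%SET = (Num.truncn (n.+1%:R * alpha) <=
     #|[set i | (score (S^~ p.1) (Z i p.1) <= score (S^~ p.1) p.2)%R]%SET|)%N.
  rewrite /Phi; congr (_ <= _)%N; apply: eq_card => i; rewrite !inE.
  congr (_ <= _); apply: eq_bigr => l _; rewrite inE indicE /Q /=;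
  congr (nat_of_bool _)%:R;
  by apply/asboolP/idP => [/mem_set|/set_mem].
by apply/seteqP; split => p; rewrite /= PE cpdp_setE.
Qed.

Lemma probability_ge_bad (E N B H : set T) (b : R) :
  measurable E -> measurable N -> measurable B -> measurable H ->
  Pr N = 0%E -> (Pr B <= b%:E)%E -> (Pr H <= b%:E)%E ->
  ~` (N `|` B `|` H) `<=` E -> ((1 - 2 * b)%:E <= Pr E)%E.
Proof.
move=> mE mN mB mH N0 Bb Hb sub.
have mU : measurable (N `|` B `|` H) by do 2 apply: measurableU => //.
have U2 : (Pr (N `|` B `|` H) <= (2 * b)%:E)%E.
  apply: le_trans (measureU2 _ (measurableU _ _ mN mB) mH) _.
  rewrite (_ : 2 * b = b + b); last by ring.
  rewrite EFinD; apply: leeD => //.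
  apply: (@le_trans _ _ (Pr N + Pr B)%E); first exact: measureU2.
  by rewrite N0 add0e.
apply: (@le_trans _ _ (Pr (~` (N `|` B `|` H)))).
  by rewrite probability_setC// EFinB leeB.
by apply: le_measure; rewrite ?inE//; exact: measurableC.
Qed.

(** The infimum need not be attained, so the events with thresholds [v + 1/(i+1)] decrease to the
    desired one and continuity from above applies. For [v = +oo] the event is everything, whence
    [b <= 1]. *)
Lemma probability_le_inf (f : T -> \bar R) (Z : set (\bar R)) (b : R) :
  measurable_fun setT f -> (forall z, Z z -> 0 <= z)%E -> b <= 1 ->
  (forall z, Z z -> (b%:E <= Pr [set w | (f w <= z)%E])%E) ->
  (b%:E <= Pr [set w | (f w <= ereal_inf Z)%E])%E.
Proof.
move=> mf Z0 b1 Zb; set v := ereal_inf Z.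
have mle z : measurable [set w | (f w <= z)%E].
  by rewrite -[X in measurable X]setTI; exact: emeasurable_fun_infty_c.
have v0 : (0 <= v)%E by apply: le_ereal_inf_tmp => z /Z0.
have [->|voo] := eqVneq v +oo%E.
  rewrite (_ : [set w | _] = setT) ?probability_setT ?lee_fin//.
  by apply/seteqP; split => w //= _; rewrite leey.
have vfin : v \is a fin_num by rewrite ge0_fin_numE// ltey.
pose F (i : nat) := [set w | (f w <= v + (i.+1%:R^-1)%:E)%E].
have FE : \bigcap_i F i = [set w | (f w <= v)%E].
  apply/seteqP; split => w /=; last first.
    by move=> h i _; apply: le_trans h _; rewrite leeDl// lee_fin.
  move=> h; apply/lee_addgt0Pr => e e0.
  have [i ie] : exists i : nat, i.+1%:R^-1 <= e.
    exists (Num.truncn e^-1).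
    have ei : 0 <= e^-1 by rewrite invr_ge0 ltW.
    by have /andP[_ h2] := truncn_itv ei; rewrite invf_ple ?posrE// ltW.
  by apply: le_trans (h i I) _; rewrite leeD2l// lee_fin.
have Fb i : (b%:E <= Pr (F i))%E.
  have /ereal_inf_lt[z Zz zv] : (v < v + (i.+1%:R^-1)%:E)%E.
    by rewrite lteDl// lte_fin.
  apply: le_trans (Zb z Zz) _; apply: le_measure; rewrite ?inE; [exact: mle|exact: mle|].
  by move=> w /= h; apply: le_trans h (ltW zv).
have cv : Pr \o F @ \oo --> Pr [set w | (f w <= v)%E].
  rewrite -FE; apply: nonincreasing_cvg_mu => //.
  - by apply: le_lt_trans (probability_le1 _ (mle _)) (ltry 1).
  - by move=> i; exact: mle.
  - by rewrite FE.
  - move=> i j ij; apply/subsetPset => w /= h; apply: le_trans h _.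
    by rewrite leeD2l// lee_fin lef_pV2 ?posrE// ler_nat.
rewrite -(cvg_lim _ cv)//; apply: lime_ge; first by apply/cvg_ex; eexists; exact: cv.
by apply: nearW => i; exact: Fb.
Qed.
End RandomSets.

(* The family [S] is indexed from 0: [S j] is the set written S_{j+1}. *)
Theorem theorem2p5 (R : realType) :
  exists c : R, 0 < c /\
  forall (d : measure_display) (T : measurableType d) (Pr : probability T R)
    (P : probability (measurableTypeR R) R)
    (n k m : nat) (alpha delta gamma : R)
    (Y : 'I_(n + n + 1) -> {RV Pr >-> R})
    (S : 'I_m -> T -> set R),
  (0 < n)%N -> (0 < k)%N -> (0 < m)%N ->
  0 < alpha < 1 -> 0 < delta -> 0 < gamma ->
  3 * delta + gamma + n%:R^-1 <= alpha ->
  iid P Y ->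
  (forall j, random_set_measurable (fun i => Y (train_idx i)) (S j)) ->
  {ae Pr, forall w,
    let Pn := empirical (fun i : 'I_n => Y (train_idx i) w) in
    [/\ forall i j : 'I_m, (i <= j)%N -> S i w `<=` S j w,
        forall j : 'I_m, Pn (S j w) = (j.+1%:R / m%:R)%:E /\
                         interval_unions k (S j w)
      & exists j : 'I_m,
          ((1 - alpha + n%:R^-1 + 3 * delta)%:E <= Pn (S j w))%E /\
          (lebesgue_measure (S j w) <=
             OPT k Pn (1 - alpha + n%:R^-1 + 3 * delta + gamma))%E]} ->
  c * Num.sqrt ((k%:R + ln n%:R) / n%:R) <= delta ->
  let C w := cpdp_set alpha (fun j => S j w)
                      (fun i : 'I_n => Y (calib_idx i) w) in
  ((1 - alpha)%:E <= Pr [set w | Y (test_idx n) w \in C w])%E /\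
  ((1 - 2 * delta)%:E <=
     Pr [set w | (lebesgue_measure (C w) <=
                    OPT k P (1 - alpha + n%:R^-1 + 4 * delta + gamma))%E])%E.
Proof.
exists 100; split => // d T Pr P n k m alpha delta gamma Y S n0 k0 m0 a01 d0 g0 hdel.
move=> iidY mS hS hc C; have /andP[a0 a1] := a01.
have nR : 0 < n%:R :> R by rewrite ltr0n.
have nV : 0 < n%:R^-1 :> R by rewrite invr_gt0.
have d13 : 3 * delta < 1 by lra.
have [kn ln0 hT hB hH] := rate_consequences n0 k0 d0 d13 hc.
have na : n%:R^-1 <= alpha by lra.
have [rn r1 r2] := rank_bounds n0 a01 na.
set r := Num.truncn (n.+1%:R * alpha) in rn r1 r2.
split.
  have [mF hF] := coverage iidY mS r; set F := (X in measurable X) in mF hF.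
  rewrite (_ : [set w | _] = ~` F); last first.
    apply/seteqP; split => w /=.
      by move=> /set_mem/(cpdp_setE _ _ _ rn) h; apply/negP; rewrite -leqNgt.
    by move/negP; rewrite -leqNgt => h; apply/mem_set/(cpdp_setE _ _ _ rn).
  rewrite probability_setC//; move: hF.
  rewrite -(fineK (fin_num_measure Pr _ mF)) -EFinM -EFinB !lee_fin => hF.
  have : n.+1%:R * fine (Pr F) <= n.+1%:R * alpha by exact: le_trans hF r1.
  by rewrite ler_pM2l ?ltr0n//; lra.
have mG := cpdp_graph (fun i => Y (calib_idx i)) rn mS.
set G := (X in measurable X) in mG.
have CG w : xsection G w = C w.
  by apply/seteqP; split => z; rewrite /xsection /=;
    [move=> /set_mem|move=> h; apply/mem_set].
have mC w : measurable (C w : set (measurableTypeR R)).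
  by rewrite -CG; exact: measurable_xsection.
have mf : measurable_fun setT (fun w => lebesgue_measure (C w)).
  rewrite (_ : (fun w => _) = lebesgue_measure \o xsection G).
    exact: measurable_fun_xsection.
  by apply/funext => w /=; rewrite CG.
have [N [mN N0 sN]] := hS.
have t0 : 0 <= delta * n%:R / 3 by rewrite divr_ge0// mulr_ge0// ltW.
have [B [mB PB] BE] := uniform_deviation iidY n0 (introT andP (conj k0 kn))
  (mulr_ge0 (ler0n _ 2) ln0) t0 hT.
(* It is enough to compare with one fixed competitor [C0], for which a pointwise deviation bound is
   available. *)
apply: (probability_le_inf mf).
- by move=> _ [C0 _ <-]; exact: measure_ge0.
- by lra.
move=> _ [C0 [C0k PC0] <-].
have mC0 := interval_unions_measurable C0k.
have train_inj : injective (@train_idx n).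
  by move=> i j /(congr1 val) /= ij; apply: ord_inj.
have iidT : iid P (fun i => Y (train_idx i)) by exact: iid_comp train_inj iidY.
pose H := [set w |
  \sum_(i < n) \1_C0 (Y (train_idx i) w) < n%:R * (fine (P C0) - delta)].
have mH : measurable H.
  pose Q (i : 'I_n) w := Y (train_idx i) w \in C0.
  pose Phi (s : {set 'I_n}) : bool :=
    \sum_(i < n) (i \in s)%:R < n%:R * (fine (P C0) - delta).
  rewrite (_ : H = [set w | Phi [set i | Q i w]%SET]).
    apply: (@measurable_pattern _ _ _ Q Phi) => i.
    rewrite (_ : [set w | _] = Y (train_idx i) @^-1` C0).
      rewrite -[X in measurable X]setTI.
      exact: (@measurable_funP _ _ _ _ setT (Y (train_idx i)) measurableT _ mC0).
    by apply/seteqP; split => w /=; rewrite /Q inE.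
  have PE w : Phi [set i | Q i w]%SET =
      (\sum_(i < n) \1_C0 (Y (train_idx i) w) < n%:R * (fine (P C0) - delta)).
    by rewrite /Phi; congr (_ < _); apply: eq_bigr => i _; rewrite inE indicE.
  by apply/seteqP; split => w; rewrite /= PE.
apply: (probability_ge_bad _ mN mB mH N0).
- rewrite -[X in measurable X]setTI.
  exact: (emeasurable_fun_infty_c measurableT mf).
- by apply: le_trans PB _; rewrite lee_fin.
- by apply: le_trans (chernoff iidT mC0 (ltW d0)) _; rewrite lee_fin.
(* The outcome [w] now avoids the null set [N], the uniform deviation event [B] and the Chernoff
   event [H] for [C0]. *)
move=> w /= bad.
have /not_orP[/not_orP[nN nB] nH] := bad.
have {sN}[nest Sk [js [js1 js2]]] := contrapT (fun h => nN (sN w h)).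
move: js1; rewrite empiricalE lee_fin => js1.
(* At least [n - n * alpha + 1] calibration points lie in [S js w], as the deviation consumes the
   [3 * delta]; with [r > (n + 1) * alpha - 1] the total exceeds [n]. *)
have subC : C w `<=` S js w.
  apply: cpdp_subset => //; rewrite -/r -(ltr_nat R) natrD.
  have := BE w _ nB (Sk js).2.
  rewrite [X in _ - X]
    (_ : _ = #|[set i | Y (calib_idx i) w \in S js w]%SET|%:R); last first.
    rewrite -sum1_card natr_sum [RHS]big_mkcond/=; apply: eq_bigr => i _.
    by rewrite inE indicE; case: (_ \in _).
  have : n%:R * (1 - alpha + n%:R^-1 + 3 * delta) <=
      \sum_(i < n) \1_(S js w) (Y (train_idx i) w).
    by rewrite -ler_pdivlMl.
  have -> : n%:R * (1 - alpha + n%:R^-1 + 3 * delta) =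
      n%:R - n%:R * alpha + 1 + 3 * (delta * n%:R).
    by field; rewrite gt_eqF.
  by move: r2; rewrite -[n.+1%:R]natr1 -[r.+1%:R]natr1; lra.
apply: le_trans (le_measure lebesgue_measure _ _ subC) _; rewrite ?inE//.
  exact: interval_unions_measurable (Sk js).2.
(* [C0] competes in the empirical problem: its frequency is at least [P C0 - delta], which turns
   [4 * delta] into [3 * delta]. *)
apply: (le_trans js2); apply: ereal_inf_lbound; exists C0 => //; split => //.
rewrite empiricalE lee_fin ler_pdivlMl//.
move: nH => /negP; rewrite -leNgt; apply: le_trans.
rewrite ler_pM2l//.
have : 1 - alpha + n%:R^-1 + 4 * delta + gamma <= fine (P C0).
  by rewrite -lee_fin fineK//; exact: fin_num_measure.
lra.
Qed.
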